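(* Let $s\in(1,2]$ and let $\alpha$ be a cardinal number. Then the set $\overline{B}_s[0,1]=\{f\in C[0,1]:\overline{\dim}_B G_f([0,1])=s\}$ is $(\alpha,\mathfrak{c})$-spaceable if and only if $\alpha<\aleph_0$.
   Context: $C[0,1]$ is the real Banach space of real-valued continuous functions on $[0,1]$ with the maximum norm. $G_f(X)=\{(x,f(x)):x\in X\}$ is the graph of $f$ over $X$, and $\overline{\dim}_B$ denotes upper box dimension. $\mathfrak{c}$ is the cardinality of $\mathbb{R}$, $\aleph_0$ that of $\mathbb{N}$. For cardinals $\alpha<\beta$, a subset $A$ of a topological vector space is $\alpha$-lineable if there is an $\alpha$-dimensional linear subspace $M\subseteq A\cup\{0\}$; it is $(\alpha,\beta)$-spaceable if it is $\alpha$-lineable and for every $\alpha$-dimensional subspace $W_\alpha\subseteq A\cup\{0\}$ there is a closed $\beta$-dimensional subspace $W_\beta$ with $W_\alpha\subseteq W_\beta\subseteq A\cup\{0\}$. *)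

(* Defs.v *)
From HB Require Import structures.
From mathcomp Require Import all_boot all_order all_algebra.
From mathcomp Require Import all_classical all_reals all_analysis.
From Stdlib Require List.
Set Implicit Arguments. Unset Strict Implicit. Unset Printing Implicit Defensive.
Import Order.TTheory GRing.Theory Num.Theory.
Import numFieldNormedType.Exports.
Local Open Scope classical_set_scope.
Local Open Scope ring_scope.

Section Defs.
Variable R : realType.

(* C[0,1], represented as the functions R -> R that are continuous on [0,1]
   and vanish outside [0,1] (linearly isomorphic to C[0,1] via restriction). *)
Definition C01 : set (R -> R) :=
  [set f | {within `[0, 1%R] : set R, continuous f} /\
           forall x : R, ~ (0 <= x <= 1) -> f x = 0].

Definition zerof : R -> R := fun _ => 0.

Definition sup_closed (M : set (R -> R)) : Prop :=
  forall f, C01 f ->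
    (forall e : R, 0 < e -> exists g, M g /\
        forall x : R, 0 <= x <= 1 -> `|f x - g x| < e) ->
    M f.

Definition lin_indep (I : Type) (b : I -> R -> R) : Prop :=
  forall (s : seq I) (c : I -> R), List.NoDup s ->
    (forall x, \sum_(i <- s) c i * b i x = 0) ->
    forall i, List.In i s -> c i = 0.

Definition span (I : Type) (b : I -> R -> R) : set (R -> R) :=
  [set f | exists (s : seq I) (c : I -> R),
      forall x, f x = \sum_(i <- s) c i * b i x].

Definition has_dim (M : set (R -> R)) (I : Type) : Prop :=
  exists b : I -> R -> R, lin_indep b /\ M = span b.

Definition card_lt (I J : Type) : Prop :=
  (exists h : I -> J, injective h) /\ ~ (exists h : J -> I, injective h).

Definition lineable (A : set (R -> R)) (I : Type) : Prop :=
  exists M, has_dim M I /\ M `<=` A `|` [set zerof].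

Definition spaceable (A : set (R -> R)) (I J : Type) : Prop :=
  card_lt I J /\ lineable A I /\
  forall W, has_dim W I -> W `<=` A `|` [set zerof] ->
    exists V, has_dim V J /\ sup_closed V /\ W `<=` V /\
              V `<=` A `|` [set zerof].

Definition mesh_square (d : R) (p : int * int) : set (R * R) :=
  [set q | (p.1)%:~R * d <= q.1 < (p.1 + 1)%:~R * d /\
           (p.2)%:~R * d <= q.2 < (p.2 + 1)%:~R * d].

Definition mesh_count (d : R) (F : set (R * R)) : R :=
  \sum_(p \in [set p : int * int | mesh_square d p `&` F !=set0]) (1 : R).

Definition upper_box_dim (F : set (R * R)) : \bar R :=
  ereal_inf [set ereal_sup [set ((ln (mesh_count d F)) / (- ln d))%:E
                           | d in (`]0, e[ : set R) ] | e in (`]0, 1[ : set R) ].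

Definition graph01 (f : R -> R) : set (R * R) :=
  [set (x, f x) | x in (`[0, 1] : set R)].

Definition Bbar (s : R) : set (R -> R) :=
  [set f | C01 f /\ upper_box_dim (graph01 f) = s%:E].

End Defs.

(* Main.v *)
Require Import Defs.
From HB Require Import structures.
From mathcomp Require Import all_boot all_order all_algebra.
From mathcomp Require Import all_classical all_reals all_analysis.
From mathcomp Require Import ring lra zify.
From Stdlib Require List.
(* Again, because [vector] also defines [span]. *)
Require Import Defs.
Set Implicit Arguments. Unset Strict Implicit. Unset Printing Implicit Defensive.
Import Order.TTheory GRing.Theory Num.Theory.
Import numFieldNormedType.Exports.
Local Open Scope classical_set_scope.
Local Open Scope ring_scope.

(** For continuous f the number of mesh squares of side d met by the graph is,
    up to a multiple of 1/d, equal to Osc_d(f)/d, where Osc_d(f) is the sum of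
    the oscillations of f over the columns of width d.  As Osc_d is a seminorm,
    upper box dimensions of sums are controlled by comparing oscillations.

    If I is infinite, take a space with basis (b_i) inside the set and replace
    infinitely many b_i by 1 + e_i b_i with e_i b_i tending to 0.  Adding
    constants does not change the dimension, so the new span is still inside the
    set, but every closed space containing it contains the constant 1, whose
    graph has dimension 1 < s.

    If I is finite and W is the given space, choose scales d_j decreasing so fast
    that the lacunary series G = 2 + sum_j a_j cos(2 pi x / d_j) has exponent s
    while Osc_{d_j}(G) on every interval dominates the oscillations at scale d_j
    of all elements of W.  Let V_0 be the closed span of the products of G with
    tents supported on the dyadic intervals [2^-k/2, 2^-k].  A nonzero v in V_0 is
    a multiple of tent * G on some dyadic interval, so w + v oscillates like G at
    the scales d_j: the sum W + V_0 is closed, lies in the set, and has a Hamel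
    basis of the cardinality of R. *)

(** * Continuous functions on [0,1] *)

(** Finite dimension enters through one function of the scale: if [A(d)] bounds [Osc_d] of every
    basis vector of W, then [Osc_d(w) <= c_w A(d)] for each w in W, with [c_w] the sum of the
    absolute coefficients. At scale [d_j] the oscillation of G is of order [j A(d_j) + d_j^(-tau_j)]
    with [tau_j] increasing to [s - 1]. The factor j outgrows every [c_w], and the power outgrows
    every [d^(-t)] with [t < s - 1]. This costs no exponent, because W lies in the set and so
    [A(d) <= d^(-t)] for small d whenever [t > s - 1]. Winning at the sparse scales [d_j] is enough,
    since the upper dimension is a limsup. The obstacle on the side of V_0 is cancellation between
    its own elements. It is excluded by letting all of them share one profile: on each dyadic
    interval only the multiple of tent * G varies. Infinite sums of such pieces keep the exponent of
    G, because down to scale d only about log(1/d) tents are visible, and each has bounded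
    variation. *)

Section Continuity.
Variable R : realType.
Implicit Types (f g : R -> R) (x y d e : R).

Lemma within_continuousP f :
  {within `[0, 1%R] : set R, continuous f} <->
  forall x, 0 <= x <= 1 -> forall e, 0 < e -> exists2 dl, 0 < dl &
    forall y, 0 <= y <= 1 -> `|x - y| < dl -> `|f x - f y| < e.
Proof.
split.
- move=> /subspace_continuousP fc x x01 e e0.
  have xI : `[0, 1%R]%classic x by rewrite /= in_itv.
  have /cvgrPdist_lt /(_ e e0) := fc x xI.
  rewrite /prop_near1 /= /within /= => /nbhs_ballP[dl /= dl0 H].
  exists dl => // y y01 xy; apply: (H y xy); by rewrite /= in_itv.
- move=> H; apply/subspace_continuousP => x; rewrite /= in_itv /= => x01.
  apply/cvgrPdist_lt => e e0; have [dl dl0 Hd] := H x x01 e e0.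
  rewrite /prop_near1 /= /within /=; apply/nbhs_ballP; exists dl => //= y xy.
  rewrite in_itv /= => y01; exact: Hd.
Qed.

Lemma C01_uniform f : C01 f -> forall e, 0 < e -> exists2 dl, 0 < dl &
  forall x y, 0 <= x <= 1 -> 0 <= y <= 1 -> `|x - y| < dl -> `|f x - f y| < e.
Proof.
move=> [/within_continuousP fc _] e e0.
(* The parameter of the covering form of compactness is the modulus [dl] tending to 0 from the
   right, so that one modulus serves all points. *)
have /compact_near_coveringP cov := @segment_compact R 0 1.
have := cov R (0%R^'+) (fun dl x => forall y, 0 <= x <= 1 -> 0 <= y <= 1 ->
   `|x - y| < dl -> `|f x - f y| < e) _ _.
case.
  move=> x; rewrite /= in_itv /= => x01.
  have [dl dl0 Hd] := fc x x01 (e / 2) ltac:(lra).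
  exists (ball x (dl / 2), [set h | h < dl / 2]).
    split; first by apply/nbhs_ballP; exists (dl / 2) => //=; lra.
    by apply: nbhs_right_lt; lra.
  move=> [x' h] /= [xx' hd] y x'01 y01 x'y.
  have := Hd x' x'01; have := Hd y y01.
  have -> : `|x - x'| < dl by move: xx'; rewrite /ball /=; lra.
  have -> : `|x - y| < dl.
    rewrite (_ : x - y = (x - x') + (x' - y)); last ring.
    by apply: (le_lt_trans (ler_normD _ _)); move: xx'; rewrite /ball /=; lra.
  move=> /(_ isT) A1 /(_ isT) A2.
  rewrite (_ : f x' - f y = (f x - f y) - (f x - f x')); last ring.
  by apply: (le_lt_trans (ler_normB _ _)); lra.
move=> dl /= dl0 H; exists (dl / 2); first by lra.
move=> x y x01 y01 xy; apply: (H (dl / 2)) => //=.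
- by rewrite sub0r normrN ger0_norm; lra.
- lra.
Qed.

Lemma C01_bounded f : C01 f -> exists2 C, 0 < C & forall x, `|f x| <= C.
Proof.
move=> [fc f0].
have fc' : {within `[0, 1%R], continuous (fun x => - f x)}.
  by move=> x; apply: cvgN; exact: fc.
have [a _ ha] := EVT_max ler01 fc; have [b _ hb] := EVT_max ler01 fc'.
exists (1 + `|f a| + `|f b|).
  by have := normr_ge0 (f a); have := normr_ge0 (f b); lra.
move=> x; have [/= x01|/f0 ->] := pselect (0 <= x <= 1).
  have := ha x; have := hb x; rewrite in_itv /= x01 => /(_ isT) h1 /(_ isT) h2.
  rewrite ler_norml; have := ler_norm (f a); have := ler_norm (- f b); rewrite normrN.
  by have := normr_ge0 (f a); have := normr_ge0 (f b); lra.
by rewrite normr0; have := normr_ge0 (f a); have := normr_ge0 (f b); lra.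
Qed.

Lemma C01_lin f g (a b : R) : C01 f -> C01 g -> C01 (fun x => a * f x + b * g x).
Proof.
move=> [fc f0] [gc g0]; split => [x|x nx].
  by apply: cvgD; (apply: cvgM; first exact: cvg_cst); [exact: fc|exact: gc].
by rewrite f0 // g0 // !mulr0 addr0.
Qed.

Lemma C01_zerof : C01 (@zerof R).
Proof. by split => [x|//]; exact: cvg_cst. Qed.

Lemma C01_IVT f a b v : C01 f -> 0 <= a <= 1 -> 0 <= b <= 1 -> f a <= v <= f b ->
  exists c, Num.min a b <= c <= Num.max a b /\ f c = v.
Proof.
move=> [fc _] a01 b01 /andP[av vb].
have [ab|ba] := leP a b.
- have [||c] := @IVT R f a b v ab _ _.
  + apply: continuous_subspaceW fc => z; rewrite /= !in_itv /=; lra.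
  + by rewrite ge_min av /= le_max vb orbT.
  + by rewrite in_itv /= => cab <-; exists c.
- have [||c] := @IVT R f b a v (ltW ba) _ _.
  + apply: continuous_subspaceW fc => z; rewrite /= !in_itv /=; lra.
  + by rewrite ge_min av orbT /= le_max vb.
  + by rewrite in_itv /= => cab <-; exists c.
Qed.

End Continuity.

(** * Mesh squares and oscillations *)

(* Two points in each of the first [N] mesh columns of width [d]. *)
Definition selection (R : realType) (d : R) (N : nat) (x y : nat -> R) : Prop :=
  forall i, (i < N)%N ->
    [/\ 0 <= x i <= 1, 0 <= y i <= 1, i%:R * d <= x i < i.+1%:R * d
      & i%:R * d <= y i < i.+1%:R * d].

(** Stands for [Osc_d(f) <= K]; quantifying over selections avoids a supremum whose existence would
    have to be proved first. *)
Definition osc_le (R : realType) (f : R -> R) (d K : R) : Prop :=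
  forall N x y, selection d N x y -> \sum_(i < N) `|f (x i) - f (y i)| <= K.

Section Mesh.
Variable R : realType.
Implicit Types (f : R -> R) (d K : R).

Definition mesh_hits d (F : set (R * R)) : set (int * int) :=
  [set p | mesh_square d p `&` F !=set0].

Lemma fsum1_ge (A : set (int * int)) (r : seq (int * int)) :
  finite_set A -> uniq r -> (forall p, p \in r -> A p) ->
  (size r)%:R <= \sum_(p \in A) (1 : R).
Proof.
move=> finA ur rA; rewrite fsbig_finite //= big_const_seq count_predT.
rewrite iter_addr addr0 ler_nat; apply: uniq_leq_size => // p /rA Ap.
by rewrite in_fset_set // inE.
Qed.

Lemma fsum1_le (A : set (int * int)) (r : seq (int * int)) :
  (forall p, A p -> p \in r) ->
  finite_set A /\ \sum_(p \in A) (1 : R) <= (size r)%:R.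
Proof.
move=> Ar; have finA : finite_set A.
  apply: (@sub_finite_set _ _ [set` r]); first by move=> p /Ar.
  by apply/finite_seqP; exists r.
split => //; rewrite fsbig_finite //= big_const_seq count_predT.
rewrite iter_addr addr0 ler_nat; apply: uniq_leq_size; first exact: finmap.fset_uniq.
by move=> p; rewrite in_fset_set // inE => /Ar.
Qed.

Definition column_squares N (lo : nat -> int) (n : nat -> nat) : seq (int * int) :=
  [seq (i%:Z, lo i + k%:Z) | i <- iota 0 N, k <- iota 0 (n i)].

Lemma column_squares_uniq N lo n : uniq (column_squares N lo n).
Proof.
apply: allpairs_uniq_dep; first exact: iota_uniq.
  by move=> i _; exact: iota_uniq.
by move=> [i k] [j l] _ _ /= [-> /addrI [->]].
Qed.

Lemma size_column_squares N lo n :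
  size (column_squares N lo n) = (\sum_(i < N) n i)%N.
Proof.
rewrite size_allpairs_dep sumnE big_map -[in RHS](big_mkord xpredT n) /index_iota subn0.
by apply: eq_bigr => i _; rewrite size_iota.
Qed.

Lemma floor_dist_le (a b : R) :
  (`|Num.floor a - Num.floor b|%N)%:R <= `|a - b| + 1.
Proof.
have := floor_itv a; have := floor_itv b; rewrite !intrD.
rewrite natr_absz intr_norm intrB.
move=> hb ha; have := ler_norm (a - b); have := ler_norm (b - a).
by rewrite (distrC b a) ler_norml; move=> *; lra.
Qed.

Lemma floor_dist_gt (a b : R) :
  `|a - b| < (`|Num.floor a - Num.floor b|%N)%:R + 1.
Proof.
have := floor_itv a; have := floor_itv b; rewrite !intrD.
rewrite natr_absz intr_norm intrB.
move: (Num.floor a)%:~R (Num.floor b)%:~R => u v hb ha.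
have := ler_norm (v - u); have := ler_norm (u - v).
by rewrite (distrC v u) ltr_norml; move=> *; lra.
Qed.

Lemma C01_rows f d x y (k : nat) : C01 f -> 0 < d ->
  0 <= x <= 1 -> 0 <= y <= 1 -> f x <= f y ->
  (k <= `|Num.floor (f x / d) - Num.floor (f y / d)|)%N ->
  exists c, Num.min x y <= c <= Num.max x y /\
    Num.floor (f c / d) = Num.floor (f x / d) + k%:Z.
Proof.
move=> fC d0 x01 y01 fxy kle.
have fl : Num.floor (f x / d) <= Num.floor (f y / d).
  by apply: le_floor; rewrite ler_pM2r ?invr_gt0.
set a := Num.floor _ in kle fl *; set b := Num.floor (f y / d) in kle fl.
(* Row offset 0 is separate: the lower edge of that row may lie below [f x], out of reach of the
   intermediate value theorem, but [x] itself is in the row. *)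
case: k kle => [|k] kle.
  exists x; rewrite addr0; split => //.
  by rewrite ge_min lexx le_max lexx.
have kb : a + k.+1%:Z <= b by lia.
have := floor_itv (f x / d); rewrite -/a => /andP[ax xa].
have bf : b%:~R <= f y / d by exact: floor_le.
have [|c [cxy fc]] := @C01_IVT R f x y ((a + k.+1%:Z)%:~R * d) fC x01 y01.
  have h1 : (a + 1)%:~R <= (a + k.+1%:Z)%:~R :> R by rewrite ler_int; lia.
  have h2 : (a + k.+1%:Z)%:~R <= b%:~R :> R by rewrite ler_int.
  apply/andP; split; first by rewrite -ler_pdivrMr //; lra.
  by rewrite -ler_pdivlMr //; lra.
exists c; split => //; rewrite fc mulfK ?gt_eqF //.
by rewrite intrKfloor.
Qed.

Lemma col_between (i : nat) d x y c :
  0 <= x <= 1 -> 0 <= y <= 1 -> i%:R * d <= x < i.+1%:R * d ->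
  i%:R * d <= y < i.+1%:R * d -> Num.min x y <= c <= Num.max x y ->
  0 <= c <= 1 /\ i%:R * d <= c < i.+1%:R * d.
Proof.
move=> h1 h2 /andP[h3 h4] /andP[h5 h6]; rewrite ge_min le_max => /andP[/orP A /orP B].
split; apply/andP; split.
- by case: A => A; lra.
- by case: B => B; lra.
- by case: A => A; apply: le_trans A.
- by case: B => B; apply: le_lt_trans B _.
Qed.

(* By intermediate values, at least [|f x - f y| / d] squares of the column of
   [x] and [y] meet the graph. *)
Lemma osc_le_mesh_count f d : C01 f -> 0 < d -> finite_set (mesh_hits d (graph01 f)) ->
  osc_le f d (d * mesh_count d (graph01 f)).
Proof.
move=> fC d0 fin N x y sel.
pose a i := if f (x i) <= f (y i) then x i else y i.
pose b i := if f (x i) <= f (y i) then y i else x i.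
pose n i := `|Num.floor (f (a i) / d) - Num.floor (f (b i) / d)|%N.+1.
pose r := column_squares N (fun i => Num.floor (f (a i) / d)) n.
have ab i : `|f (x i) - f (y i)| = `|f (a i) - f (b i)|.
  by rewrite /a /b; case: ifP => // _; rewrite distrC.
have fab i : f (a i) <= f (b i).
  by rewrite /a /b; case: ifP => // /negbT; rewrite -ltNge => /ltW.
have sab : selection d N a b.
  by move=> i /sel [? ? ? ?]; rewrite /a /b; case: ifP.
have le_r : (size r)%:R <= mesh_count d (graph01 f).
  apply: fsum1_ge => //; first exact: column_squares_uniq.
  move=> p /allpairsPdep [i [k]]; rewrite !mem_iota /= add0n => -[iN kn ->].
  have [a01 b01 ai bi] := sab i iN.
  have [|c [cab fc]] := C01_rows fC d0 a01 b01 (fab i) (k := k); first by [].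
  have [c01 ci] := col_between a01 b01 ai bi cab.
  exists (c, f c); split; last by exists c => //=; rewrite in_itv.
  split; cbn [fst snd].
    by rewrite intrD -pmulrn mulr1z natr1.
  by rewrite -fc -ler_pdivlMr // -ltr_pdivrMr // floor_itv.
apply: (@le_trans _ _ (d * (size r)%:R)); last by rewrite ler_pM2l.
rewrite size_column_squares natr_sum mulr_sumr; apply: ler_sum => i _.
rewrite ab mulrC -ler_pdivrMr //.
have := floor_dist_gt (f (a i) / d) (f (b i) / d).
by rewrite -mulrBl normrM [`|d^-1|]gtr0_norm ?invr_gt0 // -natr1 => /ltW.
Qed.

End Mesh.

(** * Covering the graph by mesh squares *)

Section MeshUpper.
Variable R : realType.
Implicit Types (f : R -> R) (d K C : R).

(** Mesh columns are half-open, so extrema need not be attained; settling for an error [d] costs one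
    extra row on each side. *)
Lemma near_maximum f (A : set R) C d : A !=set0 -> (forall x, f x <= C) -> 0 < d ->
  exists2 y, A y & forall z, A z -> f z <= f y + d.
Proof.
move=> [a Aa] fC d0; have hs : has_sup (f @` A).
  by split; [exists (f a), a|exists C => _ [x _ <-]].
have [_ [y Ay <-] hy] := sup_adherent d0 hs.
exists y => // z Az; have : f z <= sup (f @` A) by apply: ub_le_sup; [case: hs|exists z].
by lra.
Qed.

Lemma row_offset (a b q : int) : a - 1 <= q -> q - 1 <= b ->
  (absz (q - (a - 1))%R < absz (a - b)%R + 3)%N /\ a - 1 + Posz (absz (q - (a - 1))%R) = q.
Proof. by move=> h1 h2; split; lia. Qed.

Lemma mesh_cover f d : C01 f -> 0 < d < 1 -> exists N x y (r : seq (int * int)),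
  [/\ selection d N x y, forall p, mesh_hits d (graph01 f) p -> p \in r &
     (size r)%:R * d <= \sum_(i < N) `|f (x i) - f (y i)| + 8].
Proof.
move=> fC /andP[d0 d1]; have [C C0 hC] := C01_bounded fC.
(* Columns 0 to [trunc (1/d)]; the last one contains the point 1. *)
pose N := (Num.trunc d^-1).+1.
have /andP[N1 N2] : (Num.trunc d^-1)%:R <= d^-1 < N%:R.
  by apply: truncn_itv; rewrite invr_ge0 ltW.
have {}N1 : (Num.trunc d^-1)%:R * d <= 1 by rewrite -ler_pdivlMr // div1r.
have {}N2 : 1 < N%:R * d by rewrite -ltr_pdivrMr // div1r.
pose col i := [set z | 0 <= z <= 1 /\ i%:R * d <= z < i.+1%:R * d].
have col0 i : (i < N)%N -> col i (i%:R * d).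
  move=> iN; split; last by rewrite lexx -natr1 mulrDl mul1r ltrDl.
  have : i%:R * d <= (Num.trunc d^-1)%:R * d by rewrite ler_pM2r // ler_nat.
  have : 0 <= i%:R * d by rewrite mulr_ge0 // ltW.
  by lra.
have ex i : exists xy : R * R, (i < N)%N -> [/\ col i xy.1, col i xy.2 &
    forall z, col i z -> f xy.1 - d <= f z <= f xy.2 + d].
  have [iN|] := boolP (i < N)%N; last by exists (0, 0).
  have cn : col i !=set0 by exists (i%:R * d); exact: col0.
  have [|y cy hy] := @near_maximum f (col i) C d cn _ d0.
    by move=> x; have := hC x; rewrite ler_norml => /andP[].
  have [|x cx hx] := @near_maximum (fun x => - f x) (col i) C d cn _ d0.
    by move=> x; have := hC x; rewrite -normrN ler_norml => /andP[].
  by exists (x, y) => _; split => //= z cz; have := hx z cz; have := hy z cz; lra.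
have {ex} [xy hxy] := choice ex.
pose a i := f (xy i).1; pose b i := f (xy i).2.
(* Rows from one below that of [a i] to one above that of [b i]: the difference of the row numbers
   plus 3. *)
pose n i := (`|Num.floor (a i / d) - Num.floor (b i / d)|%N + 3)%N.
exists N, (fun i => (xy i).1), (fun i => (xy i).2),
  (column_squares N (fun i => Num.floor (a i / d) - 1) n); split.
- by move=> i /hxy [[? ?] [? ?] _].
- move=> [p q] [w [[sp sq] [z z01 ez]]]; subst w; cbn [fst snd] in sp, sq.
  move: z01; rewrite /= in_itv /= => z01.
  have p0 : 0 <= p.
    rewrite -ltzD1 -(@ltr0z R); case/andP: sp => _ sp.
    by rewrite -(@pmulr_lgt0 _ d) //; lra.
  case: p p0 sp => // p _; rewrite intrD -pmulrn mulr1z natr1 => sp.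
  have pN : (p < N)%N.
    rewrite ltnNge; apply/negP => Np.
    have : N%:R * d <= p%:R * d by rewrite ler_pM2r // ler_nat.
    by move/andP: sp => [sp _]; lra.
  have [_ _ /(_ z (conj z01 sp))] := hxy p pN; rewrite -/(a p) -/(b p) => /andP[h1 h2].
  have qz : Num.floor (f z / d) = q.
    by apply: floor_def; rewrite ler_pdivlMr // ltr_pdivrMr.
  have l1 : Num.floor (a p / d) - 1 <= q.
    rewrite -qz floor_ge_int intrB; have := floor_le (a p / d).
    have : (a p - d) / d <= f z / d by rewrite ler_pM2r ?invr_gt0.
    by rewrite mulrBl divff ?gt_eqF //; lra.
  have l2 : q - 1 <= Num.floor (b p / d).
    rewrite floor_ge_int intrB; have := floor_le (f z / d); rewrite qz.
    have : f z / d <= (b p + d) / d by rewrite ler_pM2r ?invr_gt0.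
    by rewrite mulrDl divff ?gt_eqF //; lra.
  have [k1 k2] := row_offset l1 l2.
  apply/allpairsPdep; exists p, (absz (q - (Num.floor (a p / d) - 1))%R).
  by rewrite !mem_iota !add0n k2.
rewrite size_column_squares natr_sum mulr_suml.
apply: (@le_trans _ _ (\sum_(i < N) (`|a i - b i| + 4 * d))).
  apply: ler_sum => i _; rewrite /n natrD.
  have := floor_dist_le (a i / d) (b i / d).
  rewrite -mulrBl normrM [`|d^-1|]gtr0_norm ?invr_gt0 // => h.
  have : (`|Num.floor (a i / d) - Num.floor (b i / d)|%N)%:R * d
    <= (`|a i - b i| / d + 1) * d by rewrite ler_pM2r.
  by rewrite mulrDl divfK ?gt_eqF // mulrDl; lra.
(* The error is [4 d] per column and [N d <= 1 + d < 2], whence the 8. *)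
rewrite big_split /= lerD2l sumr_const card_ord -mulr_natl.
by rewrite /N -natr1; lra.
Qed.

(** A sum over infinitely many squares would be 0 by convention, so finiteness must precede any
    lower bound on [mesh_count]. *)
Lemma mesh_hits_finite f d : C01 f -> 0 < d < 1 -> finite_set (mesh_hits d (graph01 f)).
Proof. by move=> fC /(mesh_cover fC)[N [x [y [r [_ /(fsum1_le R)[]]]]]]. Qed.

Lemma osc_le_mesh f d : C01 f -> 0 < d < 1 -> osc_le f d (d * mesh_count d (graph01 f)).
Proof.
move=> fC d01; apply: osc_le_mesh_count => //; first by case/andP: d01.
exact: mesh_hits_finite.
Qed.

Lemma mesh_count_le f d K : C01 f -> 0 < d < 1 -> osc_le f d K ->
  mesh_count d (graph01 f) * d <= K + 8.
Proof.
move=> fC d01 fK; have [N [x [y [r [sel /(fsum1_le R)[_ h] hr]]]]] := mesh_cover fC d01.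
apply: le_trans (le_trans hr _); last by rewrite lerD2r fK.
by rewrite ler_pM2r //; case/andP: d01.
Qed.

Lemma mesh_count_ge0 d (F : set (R * R)) : 0 <= mesh_count d F.
Proof. by apply: fsumr_ge0. Qed.

End MeshUpper.

(** * Dimension and oscillation exponents *)

Section Dimension.
Variable R : realType.
Implicit Types (f : R -> R) (d e t s r C : R).

Lemma powR_large C r : 0 < r ->
  exists2 e, 0 < e <= 1 & forall d, 0 < d < e -> C <= d `^ (- r).
Proof.
move=> r0; exists (Num.min 1 (expR (- (`|C| / r)))).
  by rewrite lt_min ltr01 expR_gt0 /= ge_min lexx.
move=> d; rewrite lt_min => /andP[d0 /andP[d1 dC]].
rewrite /powR gt_eqF //; apply: le_trans (expR_ge1Dx _).
have : ln d <= - (`|C| / r).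
  by rewrite -[leRHS]expRK ler_ln ?posrE ?expR_gt0 // ltW.
rewrite -lerNr -(ler_pM2l r0) mulrC divfK ?gt_eqF // => h.
by have := ler_norm C; lra.
Qed.

Lemma powR_eventually_le C t r : t < r ->
  exists2 e, 0 < e <= 1 & forall d, 0 < d < e -> C * d `^ (- t) <= d `^ (- r).
Proof.
move=> tr; have [|e e0 h] := @powR_large C (r - t); first by rewrite subr_gt0.
exists e => // d de; rewrite (_ : - r = - (r - t) + - t); last by ring.
rewrite powRD; last by case/andP: de => d0 _; rewrite (gt_eqF d0) implybT.
by rewrite ler_wpM2r ?powR_ge0 ?h.
Qed.

Lemma ln_ratio_le d (N r : R) : 0 < d < 1 -> 0 < N ->
  (ln N / - ln d <= r) = (N <= d `^ (- r)).
Proof.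
move=> /andP[d0 d1] N0; have ld : 0 < - ln d by rewrite oppr_gt0 ln_lt0 ?d0.
rewrite ler_pdivrMr // -ler_ln ?posrE ?powR_gt0 // ln_powR.
by rewrite mulrN mulNr.
Qed.

Lemma powRN1D d r : 0 < d -> d `^ (- (1 + r)) * d = d `^ (- r).
Proof.
move=> d0; rewrite (_ : - r = - (1 + r) + 1); last by ring.
by rewrite powRD ?powRr1 ?(gt_eqF d0) ?implybT // ltW.
Qed.

(** As the mesh count is [Osc_d(f)/d] up to a multiple of [1/d], an exponent [t >= 0] corresponds to
    upper dimension at most [1 + t]. *)
Definition osc_exponent f t : Prop :=
  exists C e, 0 < e /\ forall d, 0 < d < e -> osc_le f d (C * d `^ (- t)).

Lemma upper_box_dim_le f s : C01 f -> 1 <= s ->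
  (forall t, s - 1 < t -> osc_exponent f t) ->
  (upper_box_dim (graph01 f) <= s%:E)%E.
Proof.
move=> fC s1 H; apply/lee_addgt0Pr => r r0.
have [|C [e [e0 hC]]] := H (s - 1 + r / 2); first by lra.
(* The 8 is the error term of [mesh_count_le]; the second half of the slack [r] absorbs it together
   with [C]. *)
have [|e' /andP[e'0 e'1] he'] := @powR_eventually_le (`|C| + 8) (s - 1 + r / 2) (s - 1 + r).
  by lra.
pose m := Num.min (1 / 2) (Num.min e e').
have m0 : 0 < m by rewrite !lt_min e0 e'0; lra.
have m1 : m < 1 by rewrite !gt_min; apply/orP; left; lra.
apply: ge_ereal_inf.
exists (ereal_sup [set (ln (mesh_count d (graph01 f)) / - ln d)%:E | d in `]0, m[%classic]).
  by exists m => //=; rewrite in_itv /= m0 m1.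
apply: ge_ereal_sup => z [d]; rewrite /= in_itv /= !lt_min => /andP[d0 /and3P[d2 de de']] <-.
have d01 : 0 < d < 1 by lra.
rewrite -EFinD lee_fin.
(* Here the convention [ln 0 = 0] makes the quotient 0, which is below [s + r]. *)
have [->|n0] := eqVneq (mesh_count d (graph01 f)) 0.
  by rewrite ln0 // mul0r; lra.
have {}n0 : 0 < mesh_count d (graph01 f) by rewrite lt_neqAle eq_sym n0 mesh_count_ge0.
rewrite ln_ratio_le // -(ler_pM2r d0) (_ : s + r = 1 + (s - 1 + r)); last by ring.
rewrite powRN1D //.
apply: le_trans (mesh_count_le fC d01 (hC d _)) _; first by rewrite d0.
apply: le_trans (he' d _); last by rewrite d0.
rewrite mulrDl lerD //.
  by rewrite ler_wpM2r ?powR_ge0 ?ler_norm.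
rewrite ler_peMr // -[leLHS](powRr0 d); apply: ger_powR; lra.
Qed.

Lemma upper_box_dim_le_inv f s t : C01 f ->
  (upper_box_dim (graph01 f) <= s%:E)%E -> s - 1 < t ->
  exists2 e, 0 < e <= 1 & forall d, 0 < d < e ->
    d * mesh_count d (graph01 f) <= d `^ (- t).
Proof.
move=> fC fs st.
have : (upper_box_dim (graph01 f) < (1 + t)%:E)%E.
  by apply: le_lt_trans fs _; rewrite lte_fin; lra.
move=> /ereal_inf_lt[z [e]]; rewrite /= in_itv /= => /andP[e0 e1] <- he.
exists e => [|d de]; first by lra.
have d01 : 0 < d < 1 by lra.
have [->|n0] := eqVneq (mesh_count d (graph01 f)) 0; first by rewrite mulr0 powR_ge0.
have {}n0 : 0 < mesh_count d (graph01 f) by rewrite lt_neqAle eq_sym n0 mesh_count_ge0.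
have : (((ln (mesh_count d (graph01 f)) / - ln d)%:E) <= (1 + t)%:E)%E.
  apply: le_trans (ltW he); apply: ereal_sup_ubound.
  by exists d => //=; rewrite in_itv.
rewrite lee_fin ln_ratio_le // => h.
have d0 : 0 < d by lra.
by rewrite mulrC -(powRN1D t d0) ler_pM2r.
Qed.

Lemma osc_exponent_dim f s t : C01 f ->
  (upper_box_dim (graph01 f) <= s%:E)%E -> s - 1 < t -> osc_exponent f t.
Proof.
move=> fC fs st; have [e /andP[e0 e1] he] := upper_box_dim_le_inv fC fs st.
exists 1, e; split => // d de N x y sel; rewrite mul1r.
have d01 : 0 < d < 1 by lra.
exact: le_trans (osc_le_mesh fC d01 sel) (he d de).
Qed.

(** The infimum over [e] of suprema over [d < e] is a limsup, so large oscillation is required only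
    at some scale below each [e]. *)
Lemma upper_box_dim_ge f s : C01 f ->
  (forall t, t < s - 1 -> forall e, 0 < e -> exists d, 0 < d < e /\
     exists N x y, selection d N x y /\
       d `^ (- t) <= \sum_(i < N) `|f (x i) - f (y i)|) ->
  (s%:E <= upper_box_dim (graph01 f))%E.
Proof.
move=> fC H; apply/lee_subgt0Pr => r r0; rewrite -EFinB.
apply: le_ereal_inf_tmp => z [e] /=; rewrite in_itv /= => /andP[e0 e1] <-.
have [||d [de [N [x [y [sel hs]]]]]] := H (s - 1 - r) _ e; [lra|by []|].
have d01 : 0 < d < 1 by lra.
have d0 : 0 < d by lra.
apply: le_trans (ereal_sup_ubound _); last by exists d => //=; rewrite in_itv.
rewrite lee_fin.
have hn : d `^ (- (s - r)) <= mesh_count d (graph01 f).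
  rewrite -(ler_pM2r d0) (_ : s - r = 1 + (s - 1 - r)); last by ring.
  rewrite powRN1D // mulrC; apply: le_trans hs (osc_le_mesh fC d01 sel).
have n0 : 0 < mesh_count d (graph01 f) by apply: lt_le_trans hn; rewrite powR_gt0.
have ld : 0 < - ln d by rewrite oppr_gt0 ln_lt0.
rewrite ler_pdivlMr //; move: hn; rewrite -ler_ln ?posrE ?powR_gt0 // ln_powR.
by rewrite mulrN mulNr.
Qed.

End Dimension.

(** * Infinite index types *)

Section LinearAlgebra.
Variables (R : realType) (I : Type).
Implicit Types (b : I -> R -> R) (f g : R -> R).

Lemma list_InP (T : eqType) (x : T) (s : seq T) : List.In x s <-> x \in s.
Proof.
elim: s => [|a s IH] //=; rewrite in_cons; split.
  by case=> [->|/IH ->]; rewrite ?eqxx ?orbT.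
by case/orP => [/eqP ->|/IH]; [left|right].
Qed.

Lemma list_NoDupP (T : eqType) (s : seq T) : List.NoDup s <-> uniq s.
Proof.
elim: s => [|a s IH] /=; first by split => // _; exact: List.NoDup_nil.
split=> [h|/andP[ha hs]].
  by inversion h; subst; apply/andP; split; [apply/negP => /list_InP|apply/IH].
by apply: List.NoDup_cons; [move/list_InP; apply/negP|apply/IH].
Qed.

(** [span] admits repeated indices while [lin_indep] tests duplicate-free lists; multiplicities are
    moved into the coefficients. [{classic I}] provides the equality test on an arbitrary type. *)
Lemma span_nodup b f : span b f -> exists (s : seq I) (c : I -> R),
  List.NoDup s /\ forall x, f x = \sum_(i <- s) c i * b i x.
Proof.
move=> [s [c fE]].
exists (undup (s : seq {classic I})), (fun i => c i * (count_mem (i : {classic I}) s)%:R).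
split; first by apply/(@list_NoDupP {classic I}); exact: undup_uniq.
move=> x; rewrite fE -(@big_undup_iterop_count _ _ _ {classic I}); apply: eq_bigr => i _.
by rewrite mulrAC mulr_natr.
Qed.

Lemma span_basis b i : span b (b i).
Proof. by exists [:: i], (fun=> 1) => x; rewrite big_seq1 mul1r. Qed.

Lemma span_comb b (s : seq I) (c : I -> R) : span b (fun x => \sum_(i <- s) c i * b i x).
Proof. by exists s, c. Qed.

End LinearAlgebra.

(** * Oscillation of linear combinations and invariance under constants *)

Section Oscillation.
Variable R : realType.
Implicit Types (f g : R -> R) (a b d t K : R).

Lemma osc_le_lin f g a b d K K' : osc_le f d K -> osc_le g d K' ->
  osc_le (fun x => a * f x + b * g x) d (`|a| * K + `|b| * K').
Proof.
move=> hf hg N x y sel.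
apply: (@le_trans _ _ (`|a| * (\sum_(i < N) `|f (x i) - f (y i)|)
                     + `|b| * (\sum_(i < N) `|g (x i) - g (y i)|))).
  rewrite !mulr_sumr -big_split /=; apply: ler_sum => i _; rewrite -!normrM.
  by apply: le_trans (ler_normD _ _); rewrite le_eqVlt; apply/orP; left; apply/eqP;
     congr (`|_|); ring.
by apply: lerD; rewrite ler_wpM2l // ?hf ?hg.
Qed.

Lemma osc_exponent_lin f g a b t : osc_exponent f t -> osc_exponent g t ->
  osc_exponent (fun x => a * f x + b * g x) t.
Proof.
move=> [C [e [e0 hf]]] [C' [e' [e'0 hg]]].
exists (`|a| * C + `|b| * C'), (Num.min e e'); split; first by rewrite lt_min e0.
move=> d; rewrite lt_min => /andP[d0 /andP[de de']].
by rewrite mulrDl -!mulrA; apply: osc_le_lin; [apply: hf|apply: hg]; rewrite d0.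
Qed.

Lemma osc_le_eq f g d K : (forall x, 0 <= x <= 1 -> f x = g x) -> osc_le f d K -> osc_le g d K.
Proof.
move=> fg hf N x y sel; apply: le_trans (hf N x y sel).
by apply: ler_sum => i _; have [x01 y01 _ _] := sel i (ltn_ord i); rewrite !fg.
Qed.

Lemma osc_exponent_cst f (k : R) t : (forall x, 0 <= x <= 1 -> f x = k) -> osc_exponent f t.
Proof.
move=> fk; exists 0, 1; split => // d _; rewrite mul0r.
apply: (@osc_le_eq (fun=> k)); first by move=> x /fk.
by move=> N x y _; rewrite big1 // => i _; rewrite subrr normr0.
Qed.

Definition one01 : R -> R := fun x => if 0 <= x <= 1 then 1 else 0.

Lemma C01_one01 : C01 one01.
Proof.
split; last by rewrite /one01 => x /negP/negPf ->.
apply/within_continuousP => x x01 e e0; exists 1 => // y y01 _.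
by rewrite /one01 x01 y01 subrr normr0.
Qed.

Lemma Bbar_ndim (s : R) f : 1 < s -> C01 f -> (upper_box_dim (graph01 f) <= 1)%E ->
  ~ Bbar s f.
Proof. by move=> s1 _ h [_ fs]; move: h; rewrite fs lee_fin leNgt s1. Qed.

Lemma Bbar_one01 (s : R) : 1 < s -> ~ Bbar s one01.
Proof.
move=> s1; apply: Bbar_ndim => //; first exact: C01_one01.
apply: upper_box_dim_le => //; first exact: C01_one01.
by move=> t _; apply: (@osc_exponent_cst _ 1) => x x01; rewrite /one01 x01.
Qed.

Lemma Bbar_zerof (s : R) : 1 < s -> ~ Bbar s (@zerof R).
Proof.
move=> s1; apply: Bbar_ndim => //; first exact: C01_zerof.
apply: upper_box_dim_le => //; first exact: C01_zerof.
by move=> t _; apply: (@osc_exponent_cst _ 0).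
Qed.

Lemma upper_box_dim_shift f (k r : R) : C01 f -> 1 <= r ->
  (upper_box_dim (graph01 f) <= r%:E)%E ->
  (upper_box_dim (graph01 (fun x => (k * one01 x + 1 * f x)%R)) <= r%:E)%E.
Proof.
move=> fC r1 fr; apply: upper_box_dim_le => //; first exact: C01_lin C01_one01 fC.
move=> t rt; apply: osc_exponent_lin; last exact: osc_exponent_dim fr rt.
by apply: (@osc_exponent_cst _ 1) => x x01; rewrite /one01 x01.
Qed.

Lemma Bbar_shift (s : R) f k : 1 < s -> Bbar s f -> Bbar s (fun x => k * one01 x + 1 * f x).
Proof.
move=> s1 [fC fs]; set g := fun x => _.
have gC : C01 g by exact: C01_lin C01_one01 fC.
split; first exact: gC.
apply/eqP; rewrite eq_le; apply/andP; split.
  by apply: upper_box_dim_shift => //; rewrite ?fs // ltW.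
rewrite leNgt; apply/negP => gs.
(* The shift bound is available for [r >= 1], hence the maximum with 1. Shifting [g] back by [- k]
   then gives [f] dimension at most [r < s]. *)
have [r [r1 rs gr]] : exists r : R, [/\ 1 <= r, r < s & (upper_box_dim (graph01 g) <= r%:E)%E].
  move: gs; case: (upper_box_dim (graph01 g)) => [u| |] //.
    rewrite lte_fin => us; exists (Num.max 1 u).
    by rewrite le_max lexx gt_max s1 us lee_fin le_max lexx orbT.
  by move=> _; exists 1; rewrite leNye.
have := upper_box_dim_shift (- k) gC r1 gr.
rewrite (_ : (fun x => _) = f); last by apply/funext => x; rewrite /g; ring.
by rewrite fs lee_fin leNgt rs.
Qed.

End Oscillation.

(** * Moving an infinite basis towards the constant 1 *)

Section Infinite.
Variables (R : realType) (s : R) (I : Type).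
Hypothesis s1 : 1 < s.

Lemma shifted_comb (b : I -> R -> R) (p e : I -> R) (r : seq I) (c : I -> R) x :
  \sum_(i <- r) c i * (p i * one01 x + e i * b i x) =
  (\sum_(i <- r) c i * p i) * one01 x + 1 * \sum_(i <- r) (c i * e i) * b i x.
Proof.
rewrite mul1r mulr_suml -big_split /=; apply: eq_bigr => i _; ring.
Qed.

(** A combination of the new vectors is a constant plus some [m] in the old span. If [m] is in the
    set, so is the sum, which therefore cannot vanish; if [m = 0], the old independence kills all
    coefficients, and the constant with them. *)
Lemma shifted_basis (b : I -> R -> R) (p e : I -> R) :
  lin_indep b -> span b `<=` Bbar s `|` [set @zerof R] -> (forall i, e i != 0) ->
  let b' := fun i x => p i * one01 x + e i * b i x in
  lin_indep b' /\ span b' `<=` Bbar s `|` [set @zerof R].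
Proof.
move=> bi bs e0 b'.
have zero r c : List.NoDup r -> (forall x, \sum_(i <- r) (c i * e i) * b i x = 0) ->
    forall i, List.In i r -> c i = 0.
  move=> rn h i ir; have /eqP := bi r _ rn h i ir.
  by rewrite mulf_eq0 (negPf (e0 i)) orbF => /eqP.
split.
  move=> r c rn h; apply: zero => // x.
  have := bs _ (span_comb b r (fun i => c i * e i)); set m := fun x => _.
  case=> [mB|m0]; last by have := congr1 (fun f => f x) m0.
  have := Bbar_shift (\sum_(i <- r) c i * p i) s1 mB.
  rewrite (_ : (fun x => _) = @zerof R) => [/(Bbar_zerof s1)//|].
  by apply/funext => y; rewrite -shifted_comb h.
move=> f /span_nodup[r [c [rn fE]]].
have := bs _ (span_comb b r (fun i => c i * e i)); set m := fun x => _.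
case=> [mB|m0].
  left; have := Bbar_shift (\sum_(i <- r) c i * p i) s1 mB.
  by rewrite (_ : (fun x => _) = f) //; apply/funext => y; rewrite -shifted_comb fE.
right; apply/funext => x; rewrite fE.
apply: (@big1_seq _ _ _ {classic I}) => i /andP[_ /(@list_InP {classic I}) ir].
rewrite (zero _ _ rn _ i ir) ?mul0r // => y.
by have := congr1 (fun f => f y) m0.
Qed.

Lemma infinite_injection : infinite_set [set: I] -> exists h : nat -> I, injective h.
Proof.
move=> /infiniteP /card_leP[f]; exists (fun n => val (f (SigSub (mem_setT n)))).
move=> n m /val_inj /(@inj _ _ _ f); rewrite !inE.
by move=> /(_ Logic.I Logic.I) [].
Qed.

Lemma invSn_lt (e : R) : 0 < e -> exists n : nat, n.+1%:R^-1 < e.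
Proof.
move=> e0; exists (Num.trunc e^-1).
have /andP[_ h] : (Num.trunc e^-1)%:R <= e^-1 < (Num.trunc e^-1).+1%:R.
  by apply: truncn_itv; rewrite invr_ge0 ltW.
by rewrite -[ltRHS]invrK ltf_pV2 ?posrE ?invr_gt0.
Qed.

(* The closure of the span of the shifted basis [b'] contains the constant 1. *)
Lemma spaceable_finite : spaceable (Bbar s) I R -> finite_set [set: I].
Proof.
move=> [_ [[M [[b [bi ->]] bs]] ext]]; apply: contrapT => /infinite_injection[h hinj].
have bC i : C01 (b i).
  by case: (bs _ (span_basis b i)) => [[]//|->]; exact: C01_zerof.
(* The pair is (coefficient of the constant, factor of [b i]). The n-th injected index gets
   [(1, 1/((n+1) C))] with [C] a bound of [b i]; the pair [(0, 1)] leaves all other basis vectors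
   unchanged, so the new basis is still indexed by [I]. *)
have ex i : exists pe : R * R, pe.2 != 0 /\ (forall n, h n = i ->
    pe.1 = 1 /\ forall x, `|pe.2 * b i x| <= n.+1%:R^-1).
  have [[n hn]|no] := pselect (exists n, h n = i); last first.
    by exists (0, 1); rewrite oner_neq0; split => // n hn; case: no; exists n.
  have [C C0 hC] := C01_bounded (bC i).
  have nC0 : 0 < n.+1%:R * C by rewrite mulr_gt0.
  exists (1, (n.+1%:R * C)^-1) => /=; split; first by rewrite invr_eq0 gt_eqF.
  move=> m; rewrite -hn => /hinj ->; split => // x.
  rewrite hn normrM gtr0_norm ?invr_gt0 // mulrC ler_pdivrMr // mulrA mulVf ?mul1r ?pnatr_eq0 //; exact: hC.
have {ex} [pe hpe] := choice ex.
have [b'i b's] := shifted_basis (fun i => (pe i).1) bi bs (fun i => (hpe i).1).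
set b' := fun i => _ in b'i b's.
have [|V [_ [Vc [WV Vs]]]] := ext (span b') _ b's; first by exists b'.
have : V (@one01 R).
  apply: Vc => [|e e0]; first exact: C01_one01.
  have [n ne] := invSn_lt e0; exists (b' (h n)); split; first exact/WV/span_basis.
  move=> x x01; have [p1 hb] := (hpe (h n)).2 n erefl.
  rewrite /b' p1 mul1r opprD addrA subrr sub0r normrN.
  exact: le_lt_trans (hb x) ne.
case/Vs => [/(Bbar_one01 s1)//|/(congr1 (fun f => f 0))].
by rewrite /one01 /zerof lexx ler01 => /eqP; rewrite oner_eq0.
Qed.

End Infinite.

(** * Lacunary series *)

Section Series.
Variable R : realType.
Implicit Types (f : R -> R).

(** The intervals of radius [2 * a n] around [u n] are nested, since the step [a n] plus the next
    radius is at most [2 * a n]; the supremum of the left ends lies in all of them. *)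
Lemma nested_limit (u a : nat -> R) : (forall n, 0 <= a n) ->
  (forall n, `|u n.+1 - u n| <= a n) -> (forall n, a n.+1 <= a n / 2) ->
  exists l, forall n, `|l - u n| <= 2 * a n.
Proof.
move=> a0 ua aa; pose lo n := u n - 2 * a n; pose hi n := u n + 2 * a n.
have los n : lo n <= lo n.+1.
  by have := ua n; have := aa n; rewrite /lo ler_norml; lra.
have his n : hi n.+1 <= hi n.
  by have := ua n; have := aa n; rewrite /hi ler_norml; lra.
have lom m n : (m <= n)%N -> lo m <= lo n.
  by move=> /subnK <-; elim: (n - m)%N => // k IH; apply: le_trans IH (los _).
have him m n : (m <= n)%N -> hi n <= hi m.
  by move=> /subnK <-; elim: (n - m)%N => // k IH; apply: le_trans (his _) IH.
have lohi m n : lo m <= hi n.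
  apply: le_trans (lom m (maxn m n) (leq_maxl _ _)) _.
  apply: le_trans _ (him n (maxn m n) (leq_maxr _ _)).
  by have := a0 (maxn m n); rewrite /lo /hi; lra.
have hs : has_sup (range lo).
  by split; [exists (lo 0), 0|exists (hi 0) => _ [m _ <-]].
exists (sup (range lo)) => n; rewrite ler_norml.
have : lo n <= sup (range lo) by apply: ub_le_sup; [case: hs|exists n].
have : sup (range lo) <= hi n by apply: ge_sup; [case: hs|move=> _ [m _ <-]].
by rewrite /lo /hi; lra.
Qed.

Lemma series_limit (f : nat -> R -> R) (a : nat -> R) :
  (forall n x, `|f n x| <= a n) -> (forall n, a n.+1 <= a n / 2) ->
  exists F : R -> R, forall n x, `|F x - \sum_(k < n) f k x| <= 2 * a n.
Proof.
move=> fa aa.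
have ex x : exists l, forall n, `|l - \sum_(k < n) f k x| <= 2 * a n.
  apply: nested_limit => // n; first exact: le_trans (fa n 0).
  by rewrite big_ord_recr /= addrAC subrr add0r.
by have [F hF] := choice ex; exists F.
Qed.

Lemma halving_lt (a : nat -> R) : (forall n, 0 <= a n) ->
  (forall n, a n.+1 <= a n / 2) -> forall e, 0 < e ->
  exists n0, forall n, (n0 <= n)%N -> a n < e.
Proof.
move=> a0 aa e e0.
(* Halving beats linear growth, because [n + 2 <= 2 (n + 1)]; this replaces a logarithm. *)
have an n : a n * n.+1%:R <= a 0.
  elim: n => [|n IH]; first by rewrite mulr1.
  apply: le_trans IH; rewrite -(natr1 n.+1).
  have n1 : 1 <= n.+1%:R :> R by rewrite ler1n.
  have h1 : a n.+1 * (n.+1%:R + 1) <= a n / 2 * (n.+1%:R + 1) by rewrite ler_wpM2r ?aa //; lra.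
  have h2 : 0 <= a n * (n.+1%:R - 1) by rewrite mulr_ge0 ?subr_ge0.
  by lra.
have [n0 hn0] := @invSn_lt R (e / (a 0 + 1)) ltac:(by rewrite divr_gt0 //; have := a0 0; lra).
have a01 : 0 < a 0 + 1 by have := a0 0; lra.
have hn1 : a 0 + 1 < e * n0.+1%:R.
  move: hn0; rewrite ltr_pdivlMr // => h.
  have : n0.+1%:R * (n0.+1%:R^-1 * (a 0 + 1)) < n0.+1%:R * e by rewrite ltr_pM2l.
  by rewrite mulrA divff ?mul1r ?pnatr_eq0 // mulrC.
exists n0 => n nn; rewrite -(@ltr_pM2r _ n.+1%:R) //.
apply: le_lt_trans (an n) _.
have : e * n0.+1%:R <= e * n.+1%:R by rewrite ler_pM2l // ler_nat.
by lra.
Qed.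

Lemma within_uniform_limit f : (forall e, 0 < e -> exists g : R -> R,
    {within `[0, 1%R] : set R, continuous g} /\ forall x, `|f x - g x| <= e) ->
  {within `[0, 1%R] : set R, continuous f}.
Proof.
move=> H; apply/within_continuousP => x x01 e e0.
have [|g [/within_continuousP gc fg]] := H (e / 4); first by lra.
have [|dl dl0 hd] := gc x x01 (e / 4); first by lra.
exists dl => // y y01 /(hd y y01); have := fg x; have := fg y.
by rewrite !ler_norml !ltr_norml; lra.
Qed.

Lemma within_sum (f : nat -> R -> R) n :
  (forall k, {within `[0, 1%R] : set R, continuous (f k)}) ->
  {within `[0, 1%R] : set R, continuous (fun x => \sum_(k < n) f k x)}.
Proof.
move=> fc; elim: n => [|n IH].
  rewrite (_ : (fun _ => _) = fun=> 0); last by apply/funext => x; rewrite big_ord0.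
  by move=> x; exact: cvg_cst.
rewrite (_ : (fun _ => _) = fun x => \sum_(k < n) f k x + f n x); last first.
  by apply/funext => x; rewrite big_ord_recr.
by move=> x; apply: cvgD; [exact: IH|exact: fc].
Qed.

Lemma series_continuous (f : nat -> R -> R) (a : nat -> R) (F : R -> R) :
  (forall n, 0 <= a n) -> (forall n, a n.+1 <= a n / 2) ->
  (forall k, {within `[0, 1%R] : set R, continuous (f k)}) ->
  (forall n x, `|F x - \sum_(k < n) f k x| <= 2 * a n) ->
  {within `[0, 1%R] : set R, continuous F}.
Proof.
move=> a0 aa fc hF; apply: within_uniform_limit => e e0.
have [|n hn] := halving_lt a0 aa (e := e / 2); first by lra.
exists (fun x => \sum_(k < n) f k x); split; first exact: within_sum.
by move=> x; apply: le_trans (hF n x) _; have := hn n (leqnn n); lra.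
Qed.

Lemma cos_lipschitz (u v : R) : `|cos u - cos v| <= `|u - v|.
Proof.
wlog uv : u v / u <= v.
  by move=> h; have [/h//|/ltW/h] := leP u v; rewrite distrC [leRHS]distrC.
have [|c _ hc] := @MVT_segment R cos (fun x => - sin x) u v uv.
  by apply: continuous_subspaceT => x; exact: continuous_cos.
rewrite distrC [leRHS]distrC hc normrM ler_piMl // normrN ler_norml.
by rewrite sin_geN1 sin_le1.
Qed.

End Series.

Definition invS (R : realType) (j : nat) : R := j.+1%:R^-1.

Section InvS.
Variable R : realType.

Lemma invS_gt0 j : 0 < invS R j.
Proof. by rewrite invr_gt0. Qed.

Lemma invS_mul j : invS R j * j.+1%:R = 1.
Proof. by rewrite mulVf ?pnatr_eq0. Qed.

Lemma invSS_lt1 j : invS R j.+1 < 1.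
Proof. by rewrite invf_lt1 // ltr1n. Qed.

End InvS.

(** * Rapidly decreasing scales *)

Section Scales.
Variables (R : realType) (s : R) (A : R -> R).
Hypothesis s12 : 1 < s <= 2.
Hypothesis A0 : forall d, 0 <= A d.
Hypothesis Aexp : forall t, s - 1 < t ->
  exists2 e, 0 < e <= 1 & forall d, 0 < d < e -> A d <= d `^ (- t).
(** For [s = 2] the exponents in [Aexp] exceed 1, so that bound does not make [d * A d] small; yet
    the amplitudes of the series contain this product and must tend to 0. *)
Hypothesis Asmall : forall h, 0 < h ->
  exists2 e, 0 < e <= 1 & forall d, 0 < d < e -> d * A d <= h.
Implicit Types (d e t : R).

(** [tau] increases and [sigma] decreases to [s - 1]. [L j d] is the slope scale of term [j]: its
    two summands give the domination of [A] and of lower powers, and keeping it below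
    [d^(- sigma j)] preserves the exponent. *)
Let tau (j : nat) : R := (s - 1) * (1 - invS R j.+1).
Let sigma (j : nat) : R := s - 1 + invS R j.
Let L (j : nat) d : R := j%:R * A d + d `^ (- tau j).

Lemma tau_bounds j : 0 < tau j < s - 1.
Proof.
have h1 := invS_gt0 R j.+1; have h2 := invSS_lt1 R j.
have /andP[s1 _] := s12; rewrite /tau; apply/andP; split.
  by rewrite mulr_gt0 // subr_gt0.
by rewrite gtr_pMr ?subr_gt0 //; lra.
Qed.

Lemma L_gt0 j d : 0 < d -> 0 < L j d.
Proof. by move=> d0; rewrite /L ltr_wpDl ?mulr_ge0 ?powR_gt0. Qed.

Lemma scale_step j (B h : R) : 0 < h -> exists d, [/\ 0 < d, d < h, B <= L j d,
  d * L j d <= h & L j d <= d `^ (- sigma j)].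
Proof.
move=> h0; have /andP[t0 t1] := tau_bounds j; have /andP[s1 s2] := s12.
have j1 := invS_gt0 R j.
have jj := invS_mul R j.
pose t := s - 1 + invS R j / 2.
have [e1 /andP[e10 e11] H1] := powR_large B t0.
(* [1 - tau j > 0] because [tau j < s - 1 <= 1]; hence [d^(1 - tau j)] can be made at most
   [h / 2]. *)
have [|e2 /andP[e20 e21] H2] := @powR_large R (2 / h) (1 - tau j); first by lra.
have [|e3 /andP[e30 e31] H3] := @Asmall (h / 2 * invS R j).
  by rewrite mulr_gt0 //; lra.
have [|e4 /andP[e40 e41] H4] := @Aexp t; first by rewrite /t; lra.
have [|e5 /andP[e50 e51] H5] := @powR_eventually_le R j.+1%:R t (sigma j).
  by rewrite /t /sigma; lra.
pose m := Num.min h (Num.min e1 (Num.min e2 (Num.min e3 (Num.min e4 e5)))).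
have m0 : 0 < m by rewrite !lt_min h0 e10 e20 e30 e40 e50.
pose d := m / 2; have d0 : 0 < d by rewrite /d; lra.
have : d < m by rewrite /d; lra.
rewrite !lt_min => /andP[dh /and5P[d1 d2 d3 d4 d5]].
have {}H1 := H1 d; have {}H2 := H2 d; have {}H3 := H3 d; have {}H4 := H4 d.
have {}H5 := H5 d; rewrite d0 in H1 H2 H3 H4 H5.
exists d; split => //.
- rewrite /L; have := H1 d1; have : 0 <= j%:R * A d by rewrite mulr_ge0.
  by lra.
- have j0 : 0 <= j%:R :> R by [].
  have x1 : j%:R * (d * A d) <= h / 2.
    apply: le_trans (ler_wpM2l j0 (H3 d3)) _.
    have : h / 2 * invS R j * j%:R = h / 2 * (invS R j * j.+1%:R) - h / 2 * invS R j.
      by rewrite -natr1; ring.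
    rewrite jj.
    have : 0 <= h / 2 * invS R j by rewrite mulr_ge0 //; lra.
    by rewrite mulrC; lra.
  have x2 : d * d `^ (- tau j) <= h / 2.
    have := H2 d2; rewrite powRN.
    have pp : 0 < d `^ (1 - tau j) by rewrite powR_gt0.
    rewrite -[leLHS]invrK invf_div lef_pV2 ?posrE //; last by lra.
    rewrite powRD ?powRr1 ?(ltW d0) //.
    by rewrite (gt_eqF d0) implybT.
  by rewrite /L mulrDr mulrCA; lra.
- apply: le_trans (H5 d5); rewrite -natr1 mulrDl mul1r /L; apply: lerD.
    by rewrite ler_wpM2l ?H4.
  by apply: ger_powR; rewrite /t; lra.
Qed.

(** The growth condition keeps the total slope of the earlier terms below half of the present [L];
    the decay by 8 makes the later terms small against the present amplitude. *)
Lemma scales_exist (kappa : R) : 0 <= kappa -> exists d : nat -> R,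
  [/\ (forall j, 0 < d j) /\ (forall j, d j.+1 <= d j / 2), d 0 * L 0 (d 0) <= 1 / 16 /\ d 0 <= 1 / 16,
   forall j, (2 * kappa + 1) * L j (d j) <= L j.+1 (d j.+1),
   forall j, d j.+1 * L j.+1 (d j.+1) <= d j * L j (d j) / 8 &
   forall j, L j (d j) <= d j `^ (- sigma j)].
Proof.
move=> k0.
(* A triple holds the index, the lower bound for [L] and the upper bound [h]; the value 0 for
   [h <= 0] only makes the choice function total. *)
have ex (z : nat * R * R) : exists d, 0 < z.2 -> [/\ 0 < d, d < z.2, z.1.2 <= L z.1.1 d,
  d * L z.1.1 d <= z.2 & L z.1.1 d <= d `^ (- sigma z.1.1)].
  have [h0|h0] := ltP 0 z.2; last by exists 0.
  by have [d hd] := scale_step z.1.1 z.1.2 h0; exists d.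
have {ex} [pick hpick] := choice ex.
pose next j d := pick (j.+1, (2 * kappa + 1) * L j d, Num.min (d / 2) (d * L j d / 8)).
pose fix d j := if j is j'.+1 then next j' (d j') else pick (0%N, 0, 1 / 16).
have nextP j e : 0 < e -> [/\ 0 < next j e, next j e < Num.min (e / 2) (e * L j e / 8),
   (2 * kappa + 1) * L j e <= L j.+1 (next j e),
   next j e * L j.+1 (next j e) <= Num.min (e / 2) (e * L j e / 8) &
   L j.+1 (next j e) <= next j e `^ (- sigma j.+1)].
  move=> e0; apply: hpick => /=.
  by rewrite lt_min !divr_gt0 ?mulr_gt0 ?L_gt0.
have [|d00 d01 _ d02 d03] := hpick (0%N, 0, 1 / 16); first by rewrite /=; lra.
have dp j : 0 < d j by elim: j => [//|j IH]; case: (nextP j _ IH).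
exists d; split.
- by split => // j; have [_ + _ _ _] := nextP j _ (dp j); rewrite lt_min => /andP[/ltW].
- by split => //; rewrite ltW.
- by move=> j; have [] := nextP j _ (dp j).
- by move=> j; have [_ _ _ + _] := nextP j _ (dp j); rewrite le_min => /andP[].
- by case=> [|j] //; have [] := nextP j _ (dp j).
Qed.

(** * The lacunary series on the chosen scales *)

Section Gauge.
Variables (d : nat -> R) (F : R -> R).
Let kappa : R := pi *+ 2.
Let l j := L j (d j).
Let a j := d j * l j.
Let w j x := a j * cos (kappa * x / d j).
Hypothesis d_gt0 : forall j, 0 < d j.
Hypothesis d_half : forall j, d j.+1 <= d j / 2.
Hypothesis d0_le : d 0 <= 1 / 16.
Hypothesis l_grow : forall j, (2 * kappa + 1) * l j <= l j.+1.
Hypothesis a_decr : forall j, a j.+1 <= a j / 8.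
Hypothesis a_le : a 0 <= 1 / 16.
Hypothesis l_le : forall j, l j <= d j `^ (- sigma j).
Hypothesis F_lim : forall n x, `|F x - \sum_(k < n) w k x| <= 2 * a n.

Lemma kappa_gt0 : 0 < kappa.
Proof. by rewrite /kappa mulrn_wgt0 // pi_gt0. Qed.

Lemma l_gt0 j : 0 < l j. Proof. exact: L_gt0. Qed.

Lemma a_gt0 j : 0 < a j. Proof. by rewrite mulr_gt0 ?l_gt0. Qed.

Lemma a_halving j : a j.+1 <= a j / 2.
Proof. by have := a_decr j; have := a_gt0 j; lra. Qed.

Lemma d_lt1 j : d j < 1.
Proof.
elim: j => [|j IH]; first by have := d0_le; lra.
by have := d_half j; have := d_gt0 j; lra.
Qed.

Lemma a_le1 j : a j <= 1.
Proof.
elim: j => [|j IH]; first by have := a_le; lra.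
by have := a_decr j; have := a_gt0 j; lra.
Qed.

Lemma sum_l_le j : kappa * \sum_(k < j) l k <= l j / 2.
Proof.
elim: j => [|j IH]; first by rewrite big_ord0 mulr0 divr_ge0 // ltW // l_gt0.
by rewrite big_ord_recr /= mulrDr; have := l_grow j; rewrite mulrDl mul1r -mulrA; lra.
Qed.

Lemma w_le j x : `|w j x| <= a j.
Proof.
rewrite /w normrM gtr0_norm ?a_gt0 //; apply: ler_piMr; first exact/ltW/a_gt0.
by rewrite ler_norml cos_geN1 cos_le1.
Qed.

Lemma w_lipschitz j x y : `|w j x - w j y| <= kappa * l j * `|x - y|.
Proof.
rewrite /w -mulrBr normrM gtr0_norm ?a_gt0 //.
apply: le_trans (ler_wpM2l (ltW (a_gt0 j)) (cos_lipschitz _ _)) _.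
rewrite -mulrBl -mulrBr !normrM (gtr0_norm kappa_gt0) (gtr0_norm (x := (d j)^-1)) ?invr_gt0 //.
rewrite /a le_eqVlt; apply/orP; left; apply/eqP.
by field; rewrite gt_eqF.
Qed.

Lemma head_osc_le j x y (h : R) : `|x - y| <= h ->
  `|\sum_(k < j) w k x - \sum_(k < j) w k y| <= kappa * (\sum_(k < j) l k) * h.
Proof.
move=> xy; rewrite -sumrB; apply: le_trans (ler_norm_sum _ _ _) _.
rewrite mulr_sumr mulr_suml; apply: ler_sum => k _.
apply: le_trans (w_lipschitz k x y) _; rewrite ler_wpM2l //.
by rewrite ltW // mulr_gt0 ?kappa_gt0 ?l_gt0.
Qed.

Lemma F_le x : `|F x| <= 1 / 8.
Proof. by have := F_lim 0 x; rewrite big_ord0 subr0; have := a_le; lra. Qed.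

Lemma F_continuous : {within `[0, 1%R] : set R, continuous F}.
Proof.
apply: (series_continuous (f := w) (a := a)) => //.
- by move=> n; rewrite ltW ?a_gt0.
- exact: a_halving.
move=> k; apply: continuous_subspaceT => x.
apply: cvgM; first exact: cvg_cst.
apply: continuous_comp; last exact: continuous_cos.
apply: cvgM; last exact: cvg_cst.
by apply: cvgM; [exact: cvg_cst|exact: cvg_id].
Qed.

(** The first [j] terms are Lipschitz and the rest is at most [2 * a j] in absolute value; at most
    [2 / e] columns meet the interval. *)
Lemma F_osc_le j e : 0 < e < 1 ->
  osc_le F e (2 * (kappa * \sum_(k < j) l k) + 8 * (a j / e)).
Proof.
move=> /andP[e0 e1] N x y sel.
have Ne : N%:R * e <= 2.
  case: N sel => [|N] sel; first by rewrite mul0r.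
  by have [x01 _ xN _] := sel N (ltnSn N); rewrite -natr1 mulrDl mul1r; lra.
have S0 : 0 <= kappa * \sum_(k < j) l k.
  apply: mulr_ge0; first exact/ltW/kappa_gt0.
  by apply: sumr_ge0 => k _; exact/ltW/l_gt0.
apply: (@le_trans _ _ (\sum_(i < N) (kappa * (\sum_(k < j) l k) * e + 4 * a j))).
  apply: ler_sum => i _; have [_ _ xi yi] := sel i (ltn_ord i).
  have xy : `|x i - y i| <= e.
    by move: xi yi; rewrite -natr1 mulrDl mul1r ler_norml => xi yi; lra.
  have := head_osc_le j xy; have := F_lim j (x i); have := F_lim j (y i).
  by rewrite !ler_norml; lra.
rewrite sumr_const card_ord -[_ *+ N]mulr_natl.
have aj := a_gt0 j.
have h1 : N%:R * e * (kappa * \sum_(k < j) l k) <= 2 * (kappa * \sum_(k < j) l k).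
  by apply: ler_wpM2r.
have h2 : N%:R * e * (4 * a j / e) <= 2 * (4 * a j / e).
  by apply: ler_wpM2r => //; apply: divr_ge0; [apply: mulr_ge0|]; rewrite // ltW.
have h3 : N%:R * e * (4 * a j / e) = N%:R * (4 * a j).
  by field; rewrite gt_eqF.
have h4 : 4 * a j / e = 4 * (a j / e) by rewrite mulrA.
rewrite h3 h4 in h2.
by rewrite mulrDr (mulrC _ e) mulrA; lra.
Qed.

Lemma powR_decr (x y t : R) : 0 <= t -> 0 < x -> x <= y -> y `^ (- t) <= x `^ (- t).
Proof.
move=> t0 x0 xy; have y0 : 0 < y by lra.
rewrite !powRN lef_pV2 ?posrE ?powR_gt0 //.
by apply: ge0_ler_powR => //; rewrite nnegrE ltW.
Qed.

Lemma powR_mul1B (x t : R) : 0 < x -> x * x `^ (- t) = x `^ (1 - t).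
Proof. by move=> x0; rewrite powRD ?powRr1 ?(ltW x0) // (gt_eqF x0) implybT. Qed.

Lemma invS_le m n : (m <= n)%N -> invS R n <= invS R m.
Proof. by move=> mn; rewrite lef_pV2 ?posrE // ler_nat. Qed.

(** For [e] between [d (j+1)] and [d j], cut the series at [j+1]. The head is controlled by
    [l j <= d j ^ (-t) <= e ^ (-t)]. The tail [a (j+1) / e] is at most [e ^ (-t)] by comparing
    powers if [t <= 1], and by [a (j+1) <= 1] otherwise. *)
Lemma F_exponent t : s - 1 < t -> osc_exponent F t.
Proof.
move=> st; have /andP[s1 s2] := s12; have k0 := kappa_gt0.
have t0 : 0 <= t by lra.
have [J hJ] := @invSn_lt R (t - (s - 1)) ltac:(by rewrite subr_gt0).
have sJ j : (J <= j)%N -> sigma j <= t.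
  by move=> /invS_le; move: hJ; rewrite -/(invS R J) /sigma; lra.
exists (2 * (kappa + 1) + 8), (d J); split => // e /andP[e0 eJ].
have e1 : e < 1 by have := d_lt1 J; lra.
have ex : exists n, d n <= e.
  have [n0 hn0] := halving_lt (fun n => ltW (d_gt0 n)) d_half e0.
  by exists n0; apply/ltW/hn0.
have [n dn nmin] := ex_minnP ex.
have Jd m : (m <= J)%N -> d J <= d m.
  move=> /subnK <-; elim: (J - m)%N => // k IH; apply: le_trans IH.
  by have := d_half (k + m); have := d_gt0 (k + m); rewrite addSn; lra.
have Jn : (J < n)%N by rewrite ltnNge; apply/negP => /Jd; lra.
case: n dn nmin Jn => // j dj nmin Jj.
have ej : e < d j by rewrite ltNge; apply/negP => /nmin; rewrite ltnn.
have lt_ j' : (J <= j')%N -> l j' <= d j' `^ (- t).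
  move=> Jj'; apply: le_trans (l_le j') _; apply: ger_powR.
    by rewrite d_gt0 ltW // d_lt1.
  by rewrite lerN2 sJ.
have h1 : l j <= e `^ (- t) by apply: le_trans (lt_ j Jj) _; apply: powR_decr => //; exact: ltW.
have h2 : a j.+1 / e <= e `^ (- t).
  rewrite ler_pdivrMr // mulrC powR_mul1B //.
  have [t1|t1] := leP t 1.
    apply: le_trans (ler_wpM2l (ltW (d_gt0 j.+1)) (lt_ j.+1 (leqW Jj))) _.
    rewrite powR_mul1B //; apply: ge0_ler_powR; rewrite ?nnegrE ?subr_ge0 //; exact: ltW.
  apply: le_trans (a_le1 j.+1) _; rewrite -[leLHS](powRr0 e); apply: ger_powR; lra.
move=> N x y sel; have e01 : 0 < e < 1 by rewrite e0.
apply: le_trans (F_osc_le j.+1 e01 sel) _.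
have := sum_l_le j; rewrite big_ord_recr /= mulrDr => h3.
have h4 : kappa * l j <= kappa * e `^ (- t) by rewrite ler_pM2l.
have := l_gt0 j; rewrite mulrDl; lra.
Qed.

Lemma cos_kappaMn (n : nat) : cos (kappa * n%:R) = 1.
Proof.
by rewrite -[kappa * _]add0r mulr_natr (periodicn (@cosD2pi R)) cos0.
Qed.

Lemma cos_kappaMnhalf (n : nat) : cos (kappa * (n%:R + 1 / 2)) = -1.
Proof.
rewrite mulrDr addrC (mulr_natr kappa) (periodicn (@cosD2pi R)).
by rewrite (_ : kappa * (1 / 2) = pi) ?cospi // /kappa mulr2n; field.
Qed.

(** Half a period changes term [j] by [2 * a j]. The head moves by at most [a j / 4] and the tails
    at the two points are at most [a j / 4] each, which leaves more than [a j]. *)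
Lemma F_jump j (n : nat) :
  a j <= `|F (n%:R * d j) - F ((n%:R + 1 / 2) * d j)|.
Proof.
set x := n%:R * d j; set y := (_ + _) * _; have dj := d_gt0 j.
have xy : `|x - y| <= d j / 2.
  rewrite /x /y -mulrBl opprD addrA subrr sub0r normrM normrN gtr0_norm ?divr_gt0 //.
  by rewrite gtr0_norm //; lra.
have := head_osc_le j xy; have := F_lim j.+1 x; have := F_lim j.+1 y.
rewrite !big_ord_recr /=.
have -> : w j x = a j.
  by rewrite /w /x mulrA mulfK ?gt_eqF // cos_kappaMn mulr1.
have -> : w j y = - a j.
  by rewrite /w /y mulrA mulfK ?gt_eqF // cos_kappaMnhalf mulrN mulr1.
have aj := a_gt0 j; have ajj := a_decr j.
have : kappa * (\sum_(k < j) l k) * (d j / 2) <= a j / 4.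
  have : kappa * (\sum_(k < j) l k) * (d j / 2) <= l j / 2 * (d j / 2).
    by apply: ler_wpM2r; [rewrite divr_ge0 // ltW|exact: sum_l_le].
  by rewrite (_ : l j / 2 * (d j / 2) = a j / 4) // /a; field.
set S := kappa * _ * _ => hS; have := ler_norm (F x - F y).
by rewrite !ler_norml; lra.
Qed.

(** A selection lists all columns from 0 on, while oscillation is wanted inside [[p, q]] alone; the
    alternative [x i = y i] is padding for the columns to the left. *)
Lemma F_large_osc p q : 0 <= p -> p < q -> q <= 1 -> forall K t e, t < s - 1 -> 0 < e ->
  exists h, 0 < h < e /\ exists N x y, [/\ selection h N x y,
    forall i, (i < N)%N -> p <= x i <= q /\ p <= y i <= q \/ x i = y i &
    K * (A h + h `^ (- t)) <= \sum_(i < N) `|F (x i) - F (y i)|].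
Proof.
move=> p0 pq q1 K t e st e0.
have /andP[s1 s2] := s12.
pose Q := (q - p) / 2; have Q0 : 0 < Q by rewrite /Q; lra.
pose t' := (Num.max t 0 + (s - 1)) / 2.
have tm : t <= Num.max t 0 by rewrite le_max lexx.
have m0 : 0 <= Num.max t 0 by rewrite le_max lexx orbT.
have ms : Num.max t 0 < s - 1 by rewrite gt_max st; lra.
have tt' : t < t' by rewrite /t'; lra.
have [|e1 /andP[e10 e11] H1] := @powR_eventually_le R (`|K| / Q) t t'; first by [].
have ss : 0 < s - 1 by lra.
have [J hJ] := @invSn_lt R ((s - 1 - t') / (s - 1)) ltac:(by rewrite divr_gt0 // /t'; lra).
have tauJ j : (J <= j)%N -> t' <= tau j.
  move=> Jj; rewrite /tau.
  have := invS_le (leq_trans Jj (leqnSn j)); move: hJ; rewrite -/(invS R J) => h1 h2.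
  have : invS R j.+1 * (s - 1) <= s - 1 - t' by rewrite -ler_pdivlMr //; lra.
  by rewrite mulrBr mulr1 mulrC; lra.
have [n0 hn0] := halving_lt (fun n => ltW (d_gt0 n)) d_half
  (e := Num.min e (Num.min e1 (Q / 3))) ltac:(by rewrite !lt_min e0 e10 divr_gt0).
(* Large enough for three purposes: [d j] is small, [tau j >= t'], and the factor [j] in [L] exceeds
   [|K| / Q]. *)
pose j := (maxn n0 (maxn J (Num.trunc (`|K| / Q)).+1))%N.
have := hn0 j (leq_maxl _ _); rewrite !lt_min => /and3P[de de1 dQ].
have Jj : (J <= j)%N by rewrite /j !leq_max leqnn orbT.
have KQ0 : 0 <= `|K| / Q by rewrite divr_ge0 // ltW.
have Kj : `|K| / Q <= j%:R.
  have /andP[_ h] := truncn_itv KQ0; apply: le_trans (ltW h) _.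
  by rewrite ler_nat /j !leq_max leqnn !orbT.
have dj := d_gt0 j.
have Kl : K * (A (d j) + d j `^ (- t)) <= Q * l j.
  apply: (@le_trans _ _ (`|K| * (A (d j) + d j `^ (- t)))).
    by apply: ler_wpM2r (ler_norm K); rewrite addr_ge0 ?powR_ge0.
  rewrite (_ : `|K| = Q * (`|K| / Q)); last by field; rewrite gt_eqF.
  rewrite -mulrA ler_pM2l // mulrDr /l /L; apply: lerD; first exact: ler_wpM2r.
  apply: le_trans (H1 _ _) _; first by rewrite dj.
  by apply: ger_powR; [rewrite dj ltW // d_lt1|rewrite lerN2 tauJ].
exists (d j); split; first by rewrite dj.
pose i0 := (Num.trunc (p / d j)).+1; pose n := Num.trunc ((q - p) / d j - 2).
have /andP[i0l i0u] : (Num.trunc (p / d j))%:R <= p / d j < i0%:R.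
  by apply: truncn_itv; rewrite divr_ge0 // ltW.
have qp6 : 6 <= (q - p) / d j by rewrite ler_pdivlMr //; rewrite /Q in dQ; lra.
have /andP[nl nu] : n%:R <= (q - p) / d j - 2 < n.+1%:R by apply: truncn_itv; lra.
have {}i0l : i0%:R * d j <= p + d j.
  by rewrite -natr1 mulrDl mul1r lerD2r -ler_pdivlMr.
have {}i0u : p <= i0%:R * d j by rewrite -ler_pdivrMr // ltW.
have {}nl : n%:R * d j <= q - p - 2 * d j.
  have : n%:R * d j <= ((q - p) / d j - 2) * d j by rewrite ler_pM2r.
  by rewrite mulrBl divfK ?gt_eqF.
have {}nu : Q <= n%:R * d j.
  have : (q - p) / d j * d j <= (n.+1%:R + 2) * d j by rewrite ler_pM2r //; lra.
  by rewrite divfK ?gt_eqF // -natr1 /Q !mulrDl; rewrite /Q in dQ; lra.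
have bnd i : (i < i0 + n)%N -> i%:R * d j + d j <= q.
  move=> iN; have : i.+1%:R * d j <= (i0 + n)%:R * d j by rewrite ler_pM2r // ler_nat.
  by rewrite -natr1 natrD !mulrDl mul1r; lra.
(* From column [i0] on, the points are a maximum and the next minimum of the cosine; before it both
   points coincide. At least [Q / d j] columns are used, each contributing [a j = d j * l j]. *)
exists (i0 + n)%N, (fun i => i%:R * d j),
  (fun i => if (i0 <= i)%N then (i%:R + 1 / 2) * d j else i%:R * d j); split.
- move=> i /bnd bi; have i0' : 0 <= i%:R * d j by rewrite mulr_ge0 // ltW.
  have hS : i.+1%:R * d j = i%:R * d j + d j by rewrite -natr1 mulrDl mul1r.
  have hH : (i%:R + 1 / 2) * d j = i%:R * d j + d j / 2 by field.
  by case: ifP => _; rewrite hS ?hH; move: (i%:R * d j) i0' bi => u u0 bi; split; lra.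
- move=> i /bnd bi; case: ifP => [ii|]; last by right.
  have : i0%:R * d j <= i%:R * d j by rewrite ler_pM2r // ler_nat.
  by left; rewrite mulrDl; split; lra.
apply: le_trans Kl _.
apply: (@le_trans _ _ (\sum_(i0 <= i < i0 + n) a j)).
  rewrite sumr_const_nat addKn -[_ *+ n]mulr_natl /a mulrA.
  by rewrite ler_pM2r // l_gt0.
rewrite -(big_mkord xpredT (fun i => `|F (i%:R * d j) - F (if (i0 <= i)%N then (i%:R + 1 / 2) * d j else i%:R * d j)|)).
rewrite [leRHS](big_cat_nat (n := i0)) ?leq_addr //=.
rewrite -[leLHS]add0r; apply: lerD; first by apply: sumr_ge0.
apply: ler_sum_nat => i /andP[ii _]; rewrite ii; exact: F_jump.
Qed.

End Gauge.

(* A lacunary cosine series whose oscillation at the scales [d j] dominates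
   [A], while its exponent is [s - 1]. *)
Lemma gauge_exists : exists G : R -> R,
  [/\ {within `[0, 1%R] : set R, continuous G}, forall x, 1 <= G x <= 3,
   forall t, s - 1 < t -> osc_exponent G t &
   forall p q, 0 <= p -> p < q -> q <= 1 -> forall K t e, t < s - 1 -> 0 < e ->
    exists h, 0 < h < e /\ exists N x y, [/\ selection h N x y,
      forall i, (i < N)%N -> p <= x i <= q /\ p <= y i <= q \/ x i = y i &
      K * (A h + h `^ (- t)) <= \sum_(i < N) `|G (x i) - G (y i)|]].
Proof.
have [d [[d0 dh] [ad da] lg al ll]] := scales_exist (ltW kappa_gt0).
pose a j := d j * L j (d j); pose w j x := a j * cos (pi *+ 2 * x / d j).
have [||F hF] := @series_limit R w a.
- by move=> n x; exact: w_le.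
- by move=> n; exact: a_halving.
(* As [|F| <= 1/8], adding 2 keeps [G] away from 0, so that it can be divided by. *)
exists (fun x => 2 + F x); split.
- by move=> x; apply: cvgD; [exact: cvg_cst|exact: (F_continuous d0 al)].
- by move=> x; have := F_le ad hF x; rewrite ler_norml; lra.
- move=> t st; have := osc_exponent_lin 1 1 (@osc_exponent_cst R (fun=> 2) 2 t (fun _ _ => erefl))
    (F_exponent d0 dh da lg al ad ll hF st).
  by rewrite (_ : (fun x => _) = (fun x => 2 + F x)) //; apply/funext => x; rewrite !mul1r.
move=> p q p0 pq q1 K t e st e0.
have [h [he [N [x [y [sel xy hs]]]]]] := F_large_osc d0 dh da lg al hF p0 pq q1 K st e0.
exists h; split => //; exists N, x, y; split => //.
apply: le_trans hs _; apply: ler_sum => i _.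
by rewrite le_eqVlt; apply/orP; left; apply/eqP; congr (`|_|); ring.
Qed.

End Scales.

(** * Tents *)

Section Tents.
Variable R : realType.
Implicit Types (f g : R -> R) (x y d : R).

Definition clamp x : R := Num.max 0 (Num.min x 1).

Lemma clamp_le0 x : x <= 0 -> clamp x = 0.
Proof. by move=> x0; rewrite /clamp min_l ?max_l //; lra. Qed.

Lemma clamp_ge1 x : 1 <= x -> clamp x = 1.
Proof. by move=> x1; rewrite /clamp min_r // max_r. Qed.

Lemma clamp_id x : 0 <= x <= 1 -> clamp x = x.
Proof. by move=> /andP[x0 x1]; rewrite /clamp min_l // max_r. Qed.

Lemma clampP x : [\/ x <= 0 /\ clamp x = 0, 0 <= x <= 1 /\ clamp x = x | 1 <= x /\ clamp x = 1].
Proof.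
have [x0|/ltW x0] := leP x 0; first by constructor 1; rewrite clamp_le0.
have [x1|/ltW x1] := leP x 1; last by constructor 3; rewrite clamp_ge1.
by constructor 2; rewrite clamp_id ?x0 ?x1.
Qed.

Lemma clamp_bounds x : 0 <= clamp x <= 1.
Proof. by case: (clampP x) => [][h ->]; lra. Qed.

Lemma clamp_homo x y : x <= y -> clamp x <= clamp y.
Proof. by move=> xy; case: (clampP x) => [][h ->]; case: (clampP y) => [][h' ->]; lra. Qed.

Lemma clamp_lipschitz x y : `|clamp x - clamp y| <= `|x - y|.
Proof.
rewrite ler_norml; have := ler_norm (x - y); have := ler_norm (y - x).
rewrite (distrC y x); case: (clampP x) => [][h ->]; case: (clampP y) => [][h' ->] h1 h2; lra.
Qed.

(** The oscillation in a column is at most the increment between its ends, and these increments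
    telescope; the bound is the same at all scales. *)
Lemma osc_le_monotone f d : 0 <= d -> (forall x y, x <= y -> f x <= f y) ->
  (forall x, 0 <= f x <= 1) -> osc_le f d 1.
Proof.
move=> d0 fm fb N x y sel.
apply: (@le_trans _ _ (\sum_(0 <= i < N) (f (i.+1%:R * d) - f (i%:R * d)))).
  rewrite big_mkord; apply: ler_sum => i _; have [_ _ xi yi] := sel i (ltn_ord i).
  have hx : f (x i) <= f (i.+1%:R * d) by apply: fm; lra.
  have hy : f (y i) <= f (i.+1%:R * d) by apply: fm; lra.
  have hx' : f (i%:R * d) <= f (x i) by apply: fm; lra.
  have hy' : f (i%:R * d) <= f (y i) by apply: fm; lra.
  by rewrite ler_norml; lra.
rewrite telescope_sumr //.
by have := fb (N%:R * d); have := fb (0%:R * d); lra.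
Qed.

Definition half k : R := 2^-1 ^+ k.

Lemma halfS k : half k.+1 = half k / 2.
Proof. by rewrite /half exprS mulrC. Qed.

Lemma half_halving k : half k.+1 <= half k / 2.
Proof. by rewrite halfS. Qed.

Lemma half_gt0 k : 0 < half k.
Proof. by rewrite exprn_gt0 // invr_gt0. Qed.

Lemma half_le m n : (m <= n)%N -> half n <= half m.
Proof.
move=> /subnK <-; elim: (n - m)%N => // k IH; apply: le_trans IH.
by rewrite addSn halfS; have := half_gt0 (k + m); lra.
Qed.

Lemma half_le1 k : half k <= 1.
Proof. exact: (half_le (leq0n k)). Qed.

Definition peak k : R := half k * (3 / 4).

(** A difference of two increasing ramps, each over a quarter of [half k], so that the oscillation
    bound 2 at every scale follows from the monotone case. *)
Definition tent k x : R :=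
  clamp ((x - half k / 2) / (half k / 4)) - clamp ((x - peak k) / (half k / 4)).

Lemma peak_bounds k : half k / 2 <= peak k <= half k /\ 0 <= peak k <= 1.
Proof. by have := half_gt0 k; have := half_le1 k; rewrite /peak; lra. Qed.

Lemma tent_left k x : x <= half k / 2 -> tent k x = 0.
Proof.
move=> h; have k0 := half_gt0 k; rewrite /tent !clamp_le0 ?subrr //.
  by rewrite pmulr_lle0 ?invr_gt0 /peak; lra.
by rewrite pmulr_lle0 ?invr_gt0; lra.
Qed.

Lemma tent_right k x : half k <= x -> tent k x = 0.
Proof.
move=> h; have k0 := half_gt0 k; rewrite /tent !clamp_ge1 ?subrr //.
  by rewrite ler_pdivlMr /peak; lra.
by rewrite ler_pdivlMr; lra.
Qed.

Lemma tent_peak k : tent k (peak k) = 1.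
Proof.
have k0 := half_gt0 k; rewrite /tent subrr mul0r (@clamp_le0 0) // subr0.
by rewrite (_ : (_ - _) / _ = 1) ?clamp_ge1 // /peak; field; rewrite gt_eqF.
Qed.

Lemma tent_le1 k x : `|tent k x| <= 1.
Proof.
rewrite /tent ler_norml; have := clamp_bounds ((x - half k / 2) / (half k / 4)).
by have := clamp_bounds ((x - peak k) / (half k / 4)); lra.
Qed.

Lemma tent_ge_half k x : half k * (5 / 8) <= x <= peak k -> 1 / 2 <= tent k x.
Proof.
move=> /andP[h1 h2]; have k0 := half_gt0 k.
rewrite /tent (@clamp_le0 ((x - peak k) / _)); last first.
  by rewrite pmulr_lle0 ?invr_gt0; lra.
rewrite subr0 clamp_id.
  by rewrite ler_pdivlMr; lra.
by rewrite ler_pdivlMr ?ler_pdivrMr; rewrite /peak in h2; lra.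
Qed.

Lemma tent_osc k d : 0 <= d -> osc_le (tent k) d 2.
Proof.
move=> d0; have k0 := half_gt0 k.
have mono c : osc_le (fun x => clamp ((x - c) / (half k / 4))) d 1.
  apply: osc_le_monotone => // [x y xy|x]; last exact: clamp_bounds.
  by apply: clamp_homo; rewrite ler_pM2r ?lerD2r // invr_gt0; lra.
have := osc_le_lin 1 (-1) (mono (half k / 2)) (mono (peak k)).
rewrite normrN normr1 mulr1 (_ : 1 + 1 = 2) //.
by apply: osc_le_eq => x _; rewrite /tent mul1r mulN1r.
Qed.

Lemma tent_continuous k : {within `[0, 1%R] : set R, continuous (tent k)}.
Proof.
have cc c : {within `[0, 1%R] : set R, continuous (fun x => clamp ((x - c) / (half k / 4)))}.
  have k0 : 0 < half k / 4 by rewrite divr_gt0 ?half_gt0.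
  apply/within_continuousP => x x01 e e0; exists (e * (half k / 4)); first exact: mulr_gt0.
  move=> y y01 xy; apply: le_lt_trans (clamp_lipschitz _ _) _.
  rewrite -mulrBl normrM (gtr0_norm (x := (half k / 4)^-1)) ?invr_gt0 //.
  by rewrite ltr_pdivrMr // opprB addrA subrK.
by move=> x; apply: cvgB; exact: cc.
Qed.

Lemma tent_other j k x : half k / 2 <= x <= half k -> j != k -> tent j x = 0.
Proof.
move=> /andP[h1 h2]; rewrite neq_ltn => /orP[jk|kj].
  by apply: tent_left; rewrite -halfS; apply: le_trans h2 (half_le jk).
by apply: tent_right; apply: le_trans h1; rewrite -halfS; exact: half_le.
Qed.

End Tents.

(** * Closedness and exponents of the tent space *)

Section TentSpace.
Variables (R : realType) (G : R -> R).
Hypothesis Gc : {within `[0, 1%R] : set R, continuous G}.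
Hypothesis Gb : forall x, 1 <= G x <= 3.
Implicit Types (f g : R -> R) (x y d t : R).

(* The closed span of the functions [tent k * G]. *)
Definition tent_space : set (R -> R) := [set f | [/\ C01 f, f 0 = 0 &
  forall k x, half R k / 2 <= x <= half R k ->
    f x = f (peak R k) / G (peak R k) * tent k x * G x]].

Lemma G_gt0 x : 0 < G x.
Proof. by have := Gb x; lra. Qed.

Lemma tent_space_lin f g (a b : R) : tent_space f -> tent_space g ->
  tent_space (fun x => a * f x + b * g x).
Proof.
move=> [fC f0 fT] [gC g0 gT]; split; first exact: C01_lin.
  by rewrite f0 g0 !mulr0 addr0.
by move=> k x xk; rewrite (fT k x xk) (gT k x xk); field; rewrite gt_eqF ?G_gt0.
Qed.

Lemma tent_space_zerof : tent_space (@zerof R).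
Proof. by split; [exact: C01_zerof| |move=> k x _; rewrite /zerof !mul0r]. Qed.

(** Each defining condition of the tent space ties two values of the function linearly, and such a
    relation survives uniform limits. *)
Lemma limit_relation (V : set (R -> R)) f (x y c : R) :
  0 <= x <= 1 -> 0 <= y <= 1 ->
  (forall e : R, 0 < e -> exists g, V g /\
     forall x : R, 0 <= x <= 1 -> `|f x - g x| < e) ->
  (forall g, V g -> g x = c * g y) -> f x = c * f y.
Proof.
move=> x01 y01 fV Vr; apply/eqP; rewrite -subr_eq0; apply: contraT => ne.
have D0 : 0 < `|f x - c * f y| by rewrite normr_gt0.
have c1 : 0 < 1 + `|c| by have := normr_ge0 c; lra.
have [|g [gV fg]] := fV (`|f x - c * f y| / (1 + `|c|)); first by rewrite divr_gt0.
set e := _ / _ in fg; have eD : `|f x - c * f y| = e + `|c| * e.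
  by rewrite /e; field; rewrite gt_eqF.
have : `|f x - c * f y| <= `|f x - g x| + `|c| * `|f y - g y|.
  rewrite -normrM (_ : f x - c * f y = (f x - g x) - c * (f y - g y)) ?ler_normB //.
  by rewrite (Vr g gV); ring.
have := fg x x01; have : `|c| * `|f y - g y| <= `|c| * e.
  by rewrite ler_wpM2l // ltW // fg.
by lra.
Qed.

Lemma tent_space_closed : sup_closed tent_space.
Proof.
move=> f fC fV; split => //.
  have e : forall g, tent_space g -> g 0 = 0 * g 0 by move=> g [_ -> _]; rewrite mul0r.
  by rewrite (limit_relation _ _ fV e) ?mul0r // lexx ler01.
move=> k x xk; have [_ pk] := peak_bounds R k.
have h0 := half_gt0 R k; have h1 := half_le1 R k.
rewrite (@limit_relation _ f x (peak R k) (tent k x * G x / G (peak R k)) _ pk fV).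
- by field; rewrite gt_eqF ?G_gt0.
- by lra.
by move=> g [_ _ /(_ k x xk) ->]; field; rewrite gt_eqF ?G_gt0.
Qed.

Lemma tent_space_head f : tent_space f -> forall K x, half R K <= x <= 1 ->
  f x = (\sum_(k < K) f (peak R k) / G (peak R k) * tent k x) * G x.
Proof.
move=> [fC f0 fT]; elim=> [|K IH] x xK.
  have x1 : x = 1 by move: xK; rewrite /half expr0; lra.
  rewrite big_ord0 mul0r (fT 0%N) ?tent_right /half ?expr0 ?x1 //; last by lra.
  by rewrite mulr0 mul0r.
rewrite big_ord_recr /= mulrDl.
have [hx|xh] := leP (half R K) x.
  by rewrite tent_right // mulr0 mul0r addr0 -IH //; lra.
rewrite big1 ?mul0r ?add0r => [|k _].
  by apply: fT; rewrite -halfS; lra.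
rewrite tent_left ?mulr0 // -halfS.
by apply: le_trans (ltW xh) (half_le R (ltn_ord k)).
Qed.

(** The least such [K] is about [log(1/e) / log 2], which every negative power of [e] dominates. *)
Lemma log_half_le t : 0 < t -> exists2 C, 0 < C & forall e, 0 < e < 1 ->
  exists K : nat, half R K <= e /\ K%:R <= C * e `^ (- t).
Proof.
move=> t0; have l2 : 0 < ln (2 : R) by rewrite ln_gt0 // ltr1n.
exists (1 + (t * ln 2)^-1) => [|e /andP[e0 e1]].
  by rewrite addr_gt0 // invr_gt0 mulr_gt0.
have ex : exists n, half R n <= e.
  have [n0 hn0] := halving_lt (fun n => ltW (half_gt0 R n))
     (half_halving R) e0.
  by exists n0; apply/ltW/hn0.
have [[|n] hn nmin] := ex_minnP ex.
  by move: hn; rewrite /half expr0; lra.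
exists n.+1; split => //.
have en : e < half R n by rewrite ltNge; apply/negP => /nmin; rewrite ltnn.
have e1t : 1 <= e `^ (- t) by rewrite -[leLHS](powRr0 e); apply: ger_powR; lra.
have le : ln e < - (n%:R * ln 2).
  have : ln e < ln (half R n) by rewrite ltr_ln // posrE // half_gt0.
  by rewrite /half lnXn ?invr_gt0 // lnV ?posrE // mulNrn mulr_natl.
have h : n%:R * ln 2 * t <= e `^ (- t).
  rewrite /powR gt_eqF //; apply: le_trans (expR_ge1Dx _).
  have : t * (n%:R * ln 2) <= t * - ln e by rewrite ler_pM2l // lerNr ltW.
  by rewrite mulrN mulNr; lra.
have h' : n%:R <= (t * ln 2)^-1 * e `^ (- t).
  by rewrite mulrC ler_pdivlMr ?mulr_gt0 // mulrCA mulrA mulrC mulrA mulrC mulrA.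
by rewrite -natr1 mulrDl mul1r; lra.
Qed.

(** From the second column on the points are at least [e >= half R K], where [f / G] is a
    combination of [K] tents with coefficients at most [C], each of oscillation at most 2. The first
    column, where infinitely many tents accumulate, costs [2 * C]. *)
Lemma quotient_osc f : tent_space f -> forall C, (forall x, `|f x| <= C) ->
  forall K e, 0 < e -> half R K <= e ->
  osc_le (fun x => f x / G x) e (2 * C + 2 * C * K%:R).
Proof.
move=> fT C fC K e e0 Ke N x y sel.
have C0 : 0 <= C by apply: le_trans (fC 0).
have uC z : `|f z / G z| <= C.
  rewrite normrM normfV (gtr0_norm (G_gt0 z)) ler_pdivrMr ?G_gt0 //.
  by apply: le_trans (fC z) _; rewrite ler_peMr //; case/andP: (Gb z).
apply: (@le_trans _ _ (\sum_(i < N) ((if i == 0%N :> nat then 2 * C else 0) +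
    C * \sum_(k < K) `|tent k (x i) - tent k (y i)|))).
  apply: ler_sum => i _; have [x01 y01 xi yi] := sel i (ltn_ord i).
  have S0 : 0 <= C * \sum_(k < K) `|tent k (x i) - tent k (y i)|.
    by rewrite mulr_ge0 // sumr_ge0.
  case: eqP => [_|/eqP i0].
    by have := uC (x i); have := uC (y i); rewrite !ler_norml; lra.
  have ie : e <= i%:R * e by apply: ler_peMl; [exact: ltW|rewrite ler1n lt0n].
  rewrite add0r (tent_space_head fT (K := K)) ?(tent_space_head fT (K := K) (x := y i)); try lra.
  rewrite !mulfK ?gt_eqF ?G_gt0 // -sumrB mulr_sumr.
  apply: le_trans (ler_norm_sum _ _ _) _; apply: ler_sum => k _.
  by rewrite -mulrBr normrM ler_wpM2r.
rewrite big_split /= -mulr_sumr exchange_big /=; apply: lerD.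
  case: N sel => [|N] sel; first by rewrite big_ord0 mulr_ge0.
  by rewrite big_ord_recl /= big1 ?addr0.
rewrite [X in _ <= X](_ : _ = C * \sum_(k < K) 2); last first.
  by rewrite sumr_const card_ord -mulr_natl; ring.
rewrite ler_wpM2l //; apply: ler_sum => k _.
by apply: (tent_osc k (ltW e0)).
Qed.

(** Product rule for [f = (f / G) * G]: the factor [G] has exponent [t], and the oscillation of
    [f / G] is only logarithmic in [1/e]. *)
Lemma tent_space_exponent f t : 0 < t -> osc_exponent G t -> tent_space f ->
  osc_exponent f t.
Proof.
move=> t0 [CG [eG [eG0 hG]]] fT; have [fC0 _ _] := fT.
have [C C0 fC] := C01_bounded fC0.
have [B B0 hB] := log_half_le t0.
exists (C * CG + 3 * (2 * C + 2 * C * B)), (Num.min eG 1); split.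
  by rewrite lt_min eG0 ltr01.
move=> e; rewrite lt_min => /and3P[e0 eeG e1] N x y sel.
have [|K [hK KB]] := hB e; first by rewrite e0.
have := hG e; rewrite e0 eeG => /(_ isT) {}hG.
have hQ := quotient_osc fT fC e0 hK sel.
have uC z : `|f z / G z| <= C.
  rewrite normrM normfV (gtr0_norm (G_gt0 z)) ler_pdivrMr ?G_gt0 //.
  by apply: le_trans (fC z) _; apply: ler_peMr; [exact: ltW|by case/andP: (Gb z)].
have e1t : 1 <= e `^ (- t) by rewrite -[leLHS](powRr0 e); apply: ger_powR; lra.
apply: (@le_trans _ _ (C * \sum_(i < N) `|G (x i) - G (y i)| +
   3 * \sum_(i < N) `|f (x i) / G (x i) - f (y i) / G (y i)|)).
  rewrite !mulr_sumr -big_split /=; apply: ler_sum => i _.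
  have -> : f (x i) - f (y i) = f (x i) / G (x i) * (G (x i) - G (y i)) +
     G (y i) * (f (x i) / G (x i) - f (y i) / G (y i)).
    by field; rewrite !gt_eqF ?G_gt0.
  apply: le_trans (ler_normD _ _) _; rewrite !normrM; apply: lerD.
    by rewrite ler_wpM2r // -normrM.
  by rewrite ler_wpM2r // gtr0_norm ?G_gt0 //; case/andP: (Gb (y i)).
have := hG N x y sel => {}hG.
have h1 : C * \sum_(i < N) `|G (x i) - G (y i)| <= C * (CG * e `^ (- t)) by rewrite ler_pM2l.
have h2 : 2 * C * K%:R <= 2 * C * (B * e `^ (- t)) by rewrite ler_wpM2l // mulr_ge0 // ltW.
have h3 : 2 * C <= 2 * C * e `^ (- t) by rewrite ler_peMr // mulr_ge0 // ltW.
by lra.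
Qed.

Lemma tent_space_neq0 f : tent_space f -> f <> @zerof R -> exists k, f (peak R k) != 0.
Proof.
move=> fT fn0; apply: contrapT => no; apply: fn0; apply/funext => x; rewrite /zerof.
have [fC f0 _] := fT.
have [x01|/(fC.2 _)//] := pselect (0 <= x <= 1).
have [x0|x0] := leP x 0; first by rewrite (_ : x = 0) //; lra.
have [n0 hn0] := halving_lt (fun n => ltW (half_gt0 R n))
     (half_halving R) x0.
rewrite (tent_space_head fT (K := n0)); last by rewrite ltW ?hn0 //=; lra.
rewrite big1 ?mul0r // => k _; have [->|n] := eqVneq (f (peak R k)) 0.
  by rewrite !mul0r.
by case: no; exists k.
Qed.

End TentSpace.

(** * A geometric family in the tent space and the lower bound for sums *)

Section TentFamily.
Variables (R : realType) (G : R -> R).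
Hypothesis Gc : {within `[0, 1%R] : set R, continuous G}.
Hypothesis Gb : forall x, 1 <= G x <= 3.
Implicit Types (f g : R -> R) (x y d t : R).

Lemma C01_restrict f : {within `[0, 1%R] : set R, continuous f} ->
  C01 (fun x => if 0 <= x <= 1 then f x else 0).
Proof.
move=> /within_continuousP fc; split; last by move=> x /negP/negPf ->.
apply/within_continuousP => x x01 e e0; have [dl dl0 hd] := fc x x01 e e0.
by exists dl => // y y01 xy; rewrite x01 y01 hd.
Qed.

Lemma tent_series_limit t : 0 <= t -> t <= 1 / 2 -> exists F : R -> R,
  forall n x, `|F x - \sum_(k < n) t ^+ k * tent k x| <= 2 * t ^+ n.
Proof.
move=> t0 t1.
apply: (@series_limit R (fun k x => t ^+ k * tent k x) (fun n => t ^+ n)) => n => [x|].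
  rewrite normrM ger0_norm ?exprn_ge0 // ler_piMr ?exprn_ge0 //; exact: tent_le1.
by rewrite exprS mulrC ler_wpM2l ?exprn_ge0 //; lra.
Qed.

(** The element is [G] times the sum of [t^k * tent k]. Its values at the peaks, relative to [G],
    are the powers of [t], which later separates different parameters. *)
Lemma tent_family t : 0 < t -> t <= 1 / 2 -> exists2 v, tent_space G v &
  forall k, v (peak R k) = t ^+ k * G (peak R k).
Proof.
move=> t0 t1; have [F hF] := tent_series_limit (ltW t0) t1.
have tn0 n : 0 <= t ^+ n by rewrite exprn_ge0 // ltW.
have tn n : t ^+ n.+1 <= t ^+ n / 2.
  by rewrite exprS mulrC ler_wpM2l //; lra.
have Fc : {within `[0, 1%R] : set R, continuous F}.
  apply: (@series_continuous R (fun k x => t ^+ k * tent k x) (fun n => t ^+ n)) => // k x.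
  by apply: cvgM; [exact: cvg_cst|exact: tent_continuous].
(* At the points considered the partial sums are eventually constant, so the limit is read off
   exactly. *)
have Fv x r n : (forall m, (n <= m)%N -> \sum_(k < m) t ^+ k * tent k x = r) -> F x = r.
  move=> h; apply/eqP; rewrite -subr_eq0 -normr_eq0 eq_le normr_ge0 andbT.
  apply/ler_addgt0Pr => e e0; rewrite add0r.
  have [|n0 hn0] := halving_lt tn0 tn (e := e / 2); first by lra.
  have := hF (maxn n n0) x; rewrite h ?leq_maxl //.
  by have := hn0 (maxn n n0) (leq_maxr _ _); lra.
have F0 : F 0 = 0.
  apply: (Fv _ _ 0%N) => m _; rewrite big1 // => k _.
  by rewrite tent_left ?mulr0 //; have := half_gt0 R k; lra.
have FT k x : half R k / 2 <= x <= half R k -> F x = t ^+ k * tent k x.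
  move=> xk; apply: (Fv _ _ k.+1) => m km.
  rewrite (bigD1 (Ordinal km)) //= big1 ?addr0 // => j jk.
  by rewrite (tent_other xk) ?mulr0.
pose v x := if 0 <= x <= 1 then F x * G x else 0.
have vE x : 0 <= x <= 1 -> v x = F x * G x by rewrite /v => ->.
have vp k : v (peak R k) = t ^+ k * G (peak R k).
  have [pk p01] := peak_bounds R k.
  by rewrite vE // (FT k) // tent_peak mulr1.
exists v => //; split.
- by apply: C01_restrict => x; apply: cvgM; [exact: Fc|exact: Gc].
- by rewrite vE ?F0 ?mul0r // lexx ler01.
move=> k x xk; have h0 := half_gt0 R k; have h1 := half_le1 R k.
rewrite vp vE; last by lra.
by rewrite (FT k x xk); field; rewrite gt_eqF //; have := Gb (peak R k); lra.
Qed.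

(** On the upper half of the rising side of some tent, [f] is [r * tent * G] with [r != 0] and
    [tent >= 1/2]. There its oscillation is at least [c/2] times that of [G], less [3 * c] times
    that of the tent and less that of [w]. *)
Lemma tent_space_lower (s : R) (A : R -> R) f w (La : R) : 1 < s ->
  (forall d, 0 <= A d) ->
  (forall p q, 0 <= p -> p < q -> q <= 1 -> forall K t e, t < s - 1 -> 0 < e ->
    exists h, 0 < h < e /\ exists N (x y : nat -> R), [/\ selection h N x y,
      forall i, (i < N)%N -> p <= x i <= q /\ p <= y i <= q \/ x i = y i &
      K * (A h + h `^ (- t)) <= \sum_(i < N) `|G (x i) - G (y i)|]) ->
  tent_space G f -> f <> @zerof R -> 0 <= La ->
  (forall d, 0 < d < 1 -> osc_le w d (La * A d)) ->
  forall t, t < s - 1 -> forall e, 0 < e -> exists d, 0 < d < e /\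
    exists N (x y : nat -> R), selection d N x y /\
      d `^ (- t) <= \sum_(i < N) `|(w (x i) + f (x i)) - (w (y i) + f (y i))|.
Proof.
move=> s1 A0 Glarge fT fn0 La0 wA t st e e0.
have [k fk] := tent_space_neq0 fT fn0.
pose c := `|f (peak R k) / G (peak R k)|.
have G0 x : 0 < G x by have := Gb x; lra.
have c0 : 0 < c by rewrite normr_gt0 mulf_neq0 // invr_eq0 gt_eqF.
have h0 := half_gt0 R k; have h1 := half_le1 R k.
(* [c / 2 * K] must pay for [6 * c] lost to the tent, [La] times [A] lost to [w], and one power
   [d ^ (- t')] to be kept. *)
pose K := (6 * c + 1 + La) * 2 / c.
have cK : c * K = (6 * c + 1 + La) * 2 by rewrite /K; field; rewrite gt_eqF.
pose t' := Num.max t 0.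
have t't : t <= t' by rewrite /t' le_max lexx.
have t'0 : 0 <= t' by rewrite /t' le_max lexx orbT.
have t's : t' < s - 1 by rewrite /t' gt_max st; lra.
have p0 : 0 <= half R k * (5 / 8) by lra.
have pq : half R k * (5 / 8) < peak R k by rewrite /peak; lra.
have q1 : peak R k <= 1 by rewrite /peak; lra.
have m0 : 0 < Num.min e 1 by rewrite lt_min e0 ltr01.
have [d [de [N [x [y [sel xy hS]]]]]] := Glarge _ _ p0 pq q1 K t' _ t's m0.
move: de; rewrite lt_min => /and3P[d0 de d1].
exists d; split; first by rewrite d0.
exists N, x, y; split => //.
have d01 : 0 < d < 1 by rewrite d0.
have hw := wA d d01 N x y sel.
have hT := tent_osc k (ltW d0) sel.
have le1 : d `^ (- t) <= d `^ (- t') by apply: ger_powR; lra.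
have le2 : 1 <= d `^ (- t') by rewrite -[leLHS](powRr0 d); apply: ger_powR; lra.
apply: (@le_trans _ _ (\sum_(i < N) (c / 2 * `|G (x i) - G (y i)| -
   3 * c * `|tent k (x i) - tent k (y i)| - `|w (x i) - w (y i)|))).
  rewrite !sumrB -!mulr_sumr.
  set S := \sum_(i < N) `|G (x i) - G (y i)| in hS *.
  have : c / 2 * (K * (A d + d `^ (- t'))) <= c / 2 * S by rewrite ler_pM2l // divr_gt0.
  have -> : c / 2 * (K * (A d + d `^ (- t'))) = (6 * c + 1 + La) * (A d + d `^ (- t')).
    by rewrite mulrA (mulrAC c) cK; field.
  have := A0 d => Ad.
  have : 0 <= (6 * c + 1) * A d by rewrite mulr_ge0 //; lra.
  have : 0 <= La * d `^ (- t') by rewrite mulr_ge0 // powR_ge0.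
  have : 6 * c * 1 <= 6 * c * d `^ (- t') by rewrite ler_pM2l // mulr_gt0.
  have : 3 * c * \sum_(i < N) `|tent k (x i) - tent k (y i)| <= 3 * c * 2.
    by rewrite ler_pM2l // mulr_gt0.
  by lra.
apply: ler_sum => i _.
have hf : c / 2 * `|G (x i) - G (y i)| - 3 * c * `|tent k (x i) - tent k (y i)|
   <= `|f (x i) - f (y i)|.
  have [[xk yk]|->] := xy i (ltn_ord i); last by rewrite !subrr normr0 !mulr0 subr0.
  have [_ _ fE] := fT.
  rewrite (fE k) ?(fE k (y i)); try (by rewrite /peak in xk yk *; lra).
  have Tx := tent_ge_half xk.
  set r := f _ / _; have rc : `|r| = c by [].
  clearbody r.
  have -> : r * tent k (x i) * G (x i) - r * tent k (y i) * G (y i) =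
    r * (tent k (x i) * (G (x i) - G (y i))) - r * (G (y i) * (tent k (y i) - tent k (x i))).
    by ring.
  apply: le_trans (lerB_dist _ _); rewrite !normrM rc.
  rewrite (ger0_norm (x := tent k (x i))); last by lra.
  rewrite (gtr0_norm (G0 (y i))) (distrC (tent k (y i))).
  have /andP[_ G3] := Gb (y i).
  have n1 := normr_ge0 (G (x i) - G (y i)); have n2 := normr_ge0 (tent k (x i) - tent k (y i)).
  apply: lerB.
    by rewrite -mulrA ler_pM2l // ler_wpM2r //; lra.
  by rewrite mulrA ler_wpM2r // mulrC ler_pM2r.
have -> : w (x i) + f (x i) - (w (y i) + f (y i)) = (f (x i) - f (y i)) - (w (y i) - w (x i)).
  by ring.
apply: le_trans (lerB_dist _ _).
by rewrite (distrC (w (y i))) lerD2r.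
Qed.

End TentFamily.

(** * Closed sums *)

Definition linear_set (R : realType) (V : set (R -> R)) : Prop :=
  V (@zerof R) /\ forall f g (a b : R), V f -> V g -> V (fun x => a * f x + b * g x).

Section ClosedSum.
Variable R : realType.
Implicit Types (f g v w : R -> R) (V M : set (R -> R)).

Definition add_line V w : set (R -> R) := [set f | exists c : R, V (fun x => f x - c * w x)].

Lemma linear_add_line V w : linear_set V -> linear_set (add_line V w).
Proof.
move=> [V0 Vl]; split; first by exists 0; rewrite (_ : (fun x => _) = @zerof R) //;
  apply/funext => x; rewrite /zerof mul0r subr0.
move=> f g a b [c fV] [c' gV]; exists (a * c + b * c').
rewrite (_ : (fun x => _) = fun x => a * (f x - c * w x) + b * (g x - c' * w x)).
  exact: Vl.
by apply/funext => x; ring.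
Qed.

Lemma sub_add_line V w : V `<=` add_line V w.
Proof.
move=> f fV; exists 0; rewrite (_ : (fun x => _) = f) //.
by apply/funext => x; rewrite mul0r subr0.
Qed.

Lemma mem_add_line V w : linear_set V -> add_line V w w.
Proof.
move=> [V0 _]; exists 1; rewrite (_ : (fun x => _) = @zerof R) //.
by apply/funext => x; rewrite /zerof mul1r subrr.
Qed.

Lemma add_line_C01 V w : V `<=` @C01 R -> C01 w -> add_line V w `<=` @C01 R.
Proof.
move=> VC wC f [c fV]; have := C01_lin 1 c (VC _ fV) wC.
by rewrite (_ : (fun x => _) = f) //; apply/funext => x; ring.
Qed.

(* If [w] is at distance [e0] from [V] then, up to a factor [2 / e0], the
   coefficient of [w] in [v + c w] depends continuously on that vector; the
   coefficient of a limit is recovered as a supremum. *)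
Lemma sup_closed_add_line V w : linear_set V -> V `<=` @C01 R -> sup_closed V ->
  C01 w -> sup_closed (add_line V w).
Proof.
move=> [V0 Vl] VC Vc wC f fC fapp.
have [wV|nwV] := pselect (V w).
  apply: sub_add_line; apply: Vc => // e e0.
  have [g [[c gV] fg]] := fapp e e0; exists g; split => //.
  have := Vl _ _ 1 c gV wV.
  by rewrite (_ : (fun x => _) = g) //; apply/funext => x; ring.
have [e0 e00 hd] : exists2 e0 : R, 0 < e0 & forall v, V v ->
    exists2 x, 0 <= x <= 1 & e0 <= `|w x - v x|.
  apply: contrapT => no; apply: nwV; apply: Vc => // e e0.
  apply: contrapT => no'; apply: no; exists e => // v vV.
  apply: contrapT => no''; apply: no'; exists v; split => // x x01.
  by rewrite ltNge; apply/negP => h; apply: no''; exists x.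
pose C e c := exists v, V v /\ forall x, 0 <= x <= 1 -> `|f x - v x - c * w x| < e.
have Cex e : 0 < e -> exists c, C e c.
  move=> he; have [g [[c gV] fg]] := fapp e he; exists c, (fun x => g x - c * w x).
  by split => // x x01; rewrite (_ : _ - _ - _ = f x - g x) ?fg //; ring.
have Cdiam e c e' c' : C e c -> C e' c' -> `|c - c'| <= (e + e') / e0.
  move=> [v [vV hv]] [v' [v'V hv']].
  rewrite ler_pdivlMr //.
  have [->|ne] := eqVneq c c'.
    have z01 : 0 <= (0 : R) <= 1 by rewrite lexx ler01.
    have := le_lt_trans (normr_ge0 _) (hv 0 z01).
    have := le_lt_trans (normr_ge0 _) (hv' 0 z01).
    by rewrite subrr normr0 mul0r; lra.
  have cc : c - c' != 0 by rewrite subr_eq0.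
  (* Two approximations with different coefficients give [(c - c') w] close to [v' - v]; after
     division by [c - c'] the distance [e0] of [w] from [V] applies. *)
  have [x x01 hx] := hd _ (Vl _ _ (c - c')^-1 (- (c - c')^-1) v'V vV).
  have -> : `|c - c'| * e0 = e0 * `|c - c'| by rewrite mulrC.
  have : e0 * `|c - c'| <= `|(f x - v' x - c' * w x) - (f x - v x - c * w x)|.
    apply: le_trans (ler_wpM2r (normr_ge0 _) hx) _; rewrite -normrM.
    rewrite le_eqVlt; apply/orP; left; apply/eqP; congr (`|_|).
    by field.
  have := hv x x01; have := hv' x x01.
  have := ler_normB (f x - v' x - c' * w x) (f x - v x - c * w x).
  by lra.
pose S := [set z | exists e c, [/\ 0 < e, C e c & z = c - 2 * e / e0]].
have Sub e c : 0 < e -> C e c -> ubound S (c + 2 * e / e0).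
  move=> he hc _ [e' [c' [he' hc' ->]]].
  have := Cdiam _ _ _ _ hc' hc; have := ler_norm (c' - c).
  have : 0 <= e / e0 by rewrite divr_ge0 // ltW.
  have : 0 <= e' / e0 by rewrite divr_ge0 // ltW.
  rewrite -!mulrA mulrDl; lra.
have S0 : has_sup S.
  have [c hc] := Cex 1 ltr01.
  by split; [exists (c - 2 * 1 / e0), 1, c|exists (c + 2 * 1 / e0); exact: Sub].
have Ssup e c : 0 < e -> C e c -> `|c - sup S| <= 2 * e / e0.
  move=> he hc; have h1 : sup S <= c + 2 * e / e0 by apply: ge_sup; [case: S0|exact: Sub].
  have h2 : c - 2 * e / e0 <= sup S by apply: ub_le_sup; [case: S0|exists e, c].
  by rewrite ler_norml; lra.
exists (sup S); apply: Vc => [|h h0].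
  have := C01_lin 1 (- sup S) fC wC.
  by rewrite (_ : (fun x => _) = (fun x => f x - sup S * w x)) //; apply/funext => x; ring.
have [B B0 hB] := C01_bounded wC.
have k0 : 0 < 1 + 2 * B / e0 by rewrite addr_gt0 // divr_gt0 // mulr_gt0.
pose e := h / (1 + 2 * B / e0); have he : 0 < e by rewrite divr_gt0.
have eE : h = e + 2 * e / e0 * B by rewrite /e; field; rewrite !gt_eqF //; lra.
have [c hc] := Cex e he; have cS := Ssup e c he hc; have [v [vV hv]] := hc.
exists v; split => // x x01 /=.
rewrite (_ : f x - sup S * w x - v x = (f x - v x - c * w x) + (c - sup S) * w x); last by ring.
apply: le_lt_trans (ler_normD _ _) _; rewrite eE; apply: ltr_leD; first exact: hv.
by rewrite normrM; apply: ler_pM.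
Qed.

(** The last clause says that [V'] is [V] plus the span of [l], phrased through an arbitrary linear
    [M] containing [l]; taking [M] to be the given space splits each vector of [V'] into its two
    parts. *)
Lemma closed_extension V (l : seq (R -> R)) : linear_set V -> V `<=` @C01 R ->
  sup_closed V -> (forall w, List.In w l -> C01 w) -> exists V',
  [/\ [/\ linear_set V', V' `<=` @C01 R & sup_closed V'], V `<=` V',
     forall w, List.In w l -> V' w &
     forall M, linear_set M -> (forall w, List.In w l -> M w) ->
       forall f, V' f -> exists2 g, M g & V (fun x => f x - g x)].
Proof.
move=> Vl VC Vc; elim: l => [|w l IH] lC.
  exists V; split => // M [M0 _] _ f fV; exists (@zerof R) => //.
  by rewrite (_ : (fun x => _) = f) //; apply/funext => x; rewrite /zerof subr0.
have [|V' [[V'l V'C V'c] VV' lV' V'M]] := IH; first by move=> u ul; apply: lC; right.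
have wC : C01 w by apply: lC; left.
exists (add_line V' w); split.
- by split; [exact: linear_add_line|exact: add_line_C01|exact: sup_closed_add_line].
- by move=> f /VV'; exact: sub_add_line.
- by move=> u [<-|/lV']; [exact: mem_add_line|exact: sub_add_line].
move=> M Ml lM f [c fV']; have [|g gM gV] := V'M M Ml _ _ fV'.
  by move=> u ul; apply: lM; right.
exists (fun x => 1 * g x + c * w x).
  by apply: (Ml.2) => //; apply: lM; left.
rewrite (_ : (fun x => _) = (fun x => f x - c * w x - g x)) //.
by apply/funext => x; ring.
Qed.

Lemma linear_sum V (I : Type) (b : I -> R -> R) (r : seq I) (c : I -> R) : linear_set V ->
  (forall i, List.In i r -> V (b i)) -> V (fun x => \sum_(i <- r) c i * b i x).
Proof.
move=> [V0 Vl]; elim: r => [|i r IH] rV.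
  rewrite (_ : (fun x => _) = @zerof R) //; apply/funext => x; by rewrite big_nil.
rewrite (_ : (fun x => _) = fun x => c i * b i x + 1 * \sum_(j <- r) c j * b j x).
  by apply: Vl; [apply: rV; left|apply: IH => j jr; apply: rV; right].
by apply/funext => x; rewrite big_cons mul1r.
Qed.

Lemma span_sub V (I : Type) (b : I -> R -> R) : linear_set V -> (forall i, V (b i)) ->
  span b `<=` V.
Proof.
move=> Vl bV f [r [c fE]].
by rewrite (_ : f = fun x => \sum_(i <- r) c i * b i x); [exact: linear_sum|exact/funext].
Qed.

Lemma sum_count (I : eqType) (r s : seq I) (F : I -> R) : uniq r -> {subset s <= r} ->
  \sum_(i <- s) F i = \sum_(i <- r) (count_mem i s)%:R * F i.
Proof.
move=> ur; elim: s => [|a s IH] sr.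
  by rewrite big_nil big1 // => i _; rewrite mul0r.
rewrite big_cons IH; last by move=> i si; apply: sr; rewrite in_cons si orbT.
rewrite [RHS](eq_bigr (fun i => (a == i)%:R * F i + (count_mem i s)%:R * F i)); last first.
  by move=> i _; rewrite -mulrDl -natrD.
rewrite big_split /=; congr (_ + _).
have ar : a \in r by apply: sr; rewrite in_cons eqxx.
rewrite (bigD1_seq a) //= eqxx mul1r big1 ?addr0 // => i ia.
by rewrite eq_sym (negPf ia) mul0r.
Qed.

Lemma linear_span (I : Type) (b : I -> R -> R) : linear_set (span b).
Proof.
split; first by exists [::], (fun=> 0) => x; rewrite big_nil.
move=> f g u v [r [c fE]] [r' [c' gE]].
pose q := undup ((r : seq {classic I}) ++ r').
pose n (s : seq {classic I}) (i : {classic I}) : R := (count_mem i s)%:R.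
exists q, (fun i => u * (n r i * c i) + v * (n r' i * c' i)) => x.
rewrite fE gE (@sum_count {classic I} q r) ?undup_uniq //; last first.
  by move=> i ir; rewrite mem_undup mem_cat ir.
rewrite (@sum_count {classic I} q r') ?undup_uniq //; last first.
  by move=> i ir; rewrite mem_undup mem_cat ir orbT.
rewrite !mulr_sumr -big_split /=; apply: eq_bigr => i _.
by rewrite /n; ring.
Qed.

End ClosedSum.

(** * Hamel bases of the cardinality of the continuum *)

Section HamelBasis.
Variable R : realType.
Implicit Types (f g : R -> R) (V B : set (R -> R)).

Definition free_set B : Prop := forall (r : seq (R -> R)) (c : (R -> R) -> R),
  uniq r -> (forall f, f \in r -> B f) -> (forall x, \sum_(f <- r) c f * f x = 0) ->
  forall f, f \in r -> c f = 0.

Lemma hamel_extension V B0 : B0 `<=` V -> free_set B0 -> exists B,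
  [/\ B0 `<=` B, B `<=` V, free_set B & forall f, V f -> exists (r : seq (R -> R)) c,
    (forall g, g \in r -> B g) /\ forall x, f x = \sum_(g <- r) c g * g x].
Proof.
move=> B0V B0f.
(* [B0] is adjoined in the freeness condition so that the union of the empty chain, the empty set,
   also has the property. *)
pose P := [set X : set (R -> R) | X `<=` V /\ free_set (X `|` B0)].
have [F FP Ftot|A [[AV Af] Amax]] := @Zorn_bigcup _ P.
  split; first by move=> f [X FX Xf]; exact: (FP _ FX).1.
  move=> r c ur rB.
  (* A relation involves finitely many vectors, hence lies in a single member of the chain together
     with [B0]. *)
  suff [X [XF rX]] : exists X, (X = set0 \/ F X) /\ forall f, f \in r -> (X `|` B0) f.
    case: XF => [X0|/FP[_ Xf]]; last exact: Xf.
    by apply: B0f => // f /rX; rewrite X0 set0U.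
  elim: r rB {ur} => [|f r IH] rB; first by exists set0; split => //; left.
  have [|X [XF rX]] := IH; first by move=> g gr; apply: rB; rewrite in_cons gr orbT.
  have := rB f; rewrite in_cons eqxx => /(_ isT)[[Y FY Yf]|fB]; last first.
    by exists X; split => // g; rewrite in_cons => /orP[/eqP ->|/rX//]; right.
  case: XF => [X0|FX].
    exists Y; split; first by right.
    move=> g; rewrite in_cons => /orP[/eqP ->|/rX]; first by left.
    by rewrite X0 set0U; right.
  have [XY|YX] := Ftot _ _ FX FY.
    exists Y; split; first by right.
    by move=> g; rewrite in_cons => /orP[/eqP ->|/rX []]; [left|move/XY; left|right].
  exists X; split; first by right.
  by move=> g; rewrite in_cons => /orP[/eqP ->|/rX//]; left; exact: YX.
exists (A `|` B0); split => //.
- by move=> f [/AV|/B0V].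
move=> f fV; have [fB|nfB] := pselect ((A `|` B0) f).
  exists [:: f], (fun=> 1); split; first by move=> g; rewrite inE => /eqP ->.
  by move=> x; rewrite big_seq1 mul1r.
have nfree : ~ free_set ((A `|` [set f]) `|` B0).
  move=> h; apply: (Amax (A `|` [set f])); last by split => // g [/AV|->].
  by split; [move=> g; left|move=> /(_ f (or_intror erefl)) fA; apply: nfB; left].
have [r [c [ur rB r0 [g [gr cg]]]]] : exists (r : seq (R -> R)) c,
    [/\ uniq r, forall g, g \in r -> ((A `|` [set f]) `|` B0) g,
       forall x, \sum_(g <- r) c g * g x = 0 & exists g, g \in r /\ c g <> 0].
  apply: contrapT => no; apply: nfree => r c ur rB r0 g gr.
  by apply: contrapT => cg; apply: no; exists r, c; split => //; exists g.
have remB h : h \in rem f r -> (A `|` B0) h.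
  rewrite (rem_filter _ ur) mem_filter => /andP[/= hf /rB [[hA|hf']|hB]]; [by left| |by right].
  by move: hf; rewrite hf' eqxx.
have cf : c f != 0.
  apply/eqP => cf; apply: cg.
  have [gf|gf] := eqVneq g f; first by rewrite gf.
  apply: (Af (rem f r) c) => //; first exact: rem_uniq.
    move=> x; have [fr|fr] := boolP (f \in r).
      by have := r0 x; rewrite (big_rem f) //= cf mul0r add0r.
    by rewrite (rem_id fr).
  by rewrite (rem_filter _ ur) mem_filter /= gf.
have fr : f \in r.
  apply: contraT => fr; case: cg; move: remB; rewrite (rem_id fr) => remB.
  exact: (Af r c).
exists (rem f r), (fun h => - c h / c f); split => // x.
have := r0 x; rewrite (big_rem f) //= => /eqP; rewrite addr_eq0 => /eqP h.
apply: (mulfI cf); rewrite h -sumrN mulr_sumr; apply: eq_bigr => k _.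
by field.
Qed.

Lemma has_dim_of_bijection V B (phi : R -> R -> R) : linear_set V -> B `<=` V ->
  free_set B ->
  (forall f, V f -> exists (r : seq (R -> R)) c,
    (forall g, g \in r -> B g) /\ forall x, f x = \sum_(g <- r) c g * g x) ->
  set_bij setT B phi -> has_dim V R.
Proof.
move=> Vl BV Bf Bs [phiB phii phis].
have ex f : exists r, B f -> phi r = f.
  have [fB|nB] := pselect (B f); last by exists 0.
  by have [r _ hr] := phis f fB; exists r.
have {ex} [psi hpsi] := choice ex.
have phiBr r : B (phi r) by exact: phiB.
have psiK : cancel phi psi.
  by move=> r; apply: phii; rewrite ?inE //; exact: hpsi.
exists phi; split.
  move=> r c /list_NoDupP ur r0 i /list_InP ir.
  have := Bf (map phi r) (c \o psi); rewrite map_inj_uniq; last exact: can_inj psiK.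
  move=> /(_ ur) h; rewrite -(psiK i); apply: h.
  - by move=> f /mapP[k _ ->].
  - move=> x; rewrite big_map -[RHS](r0 x); apply: eq_bigr => k _.
    by rewrite /= psiK.
  - by apply/mapP; exists i.
apply/seteqP; split; last by apply: span_sub => // r; exact/BV.
move=> f /Bs[r [c [rB fE]]]; exists (map psi r), (c \o phi) => x.
rewrite fE big_map !big_seq; apply: eq_bigr => g /rB gB.
by rewrite /= hpsi.
Qed.

End HamelBasis.

(** * Coding continuous functions by real numbers *)

Section Cardinality.
Variable R : realType.

(** Digits 0 and 1 in base 8: at the first difference the gap [a n] exceeds the two tails, which
    together are at most [a n / 2]. *)
Lemma bits_injection : exists E : (nat -> bool) -> R, injective E.
Proof.
pose a (n : nat) : R := 8^-1 ^+ n.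
have a0 n : 0 < a n by rewrite exprn_gt0 // invr_gt0.
have aS n : a n.+1 = a n / 8 by rewrite /a exprS mulrC.
pose u (b : nat -> bool) n : R := \sum_(k < n) (b k)%:R * a k.
have ex b : exists l, forall n, `|l - u b n| <= 2 * a n.
  apply: nested_limit => n; first exact: ltW.
    rewrite /u big_ord_recr /= addrAC subrr add0r ger0_norm ?mulr_ge0 ?(ltW (a0 n)) //.
    by rewrite ler_piMl ?(ltW (a0 n)) // lern1 leq_b1.
  by rewrite aS; have := a0 n; lra.
have [E hE] := choice ex; exists E => b b' EE.
apply: contrapT => ne.
have ex' : exists n, b n != b' n.
  apply: contrapT => no; apply: ne; apply/funext => n; apply/eqP; apply: contraT => h.
  by case: no; exists n.
have [n bn nmin] := ex_minnP ex'.
have uu : u b n = u b' n.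
  apply: eq_bigr => k _; congr (_%:R * _); congr nat_of_bool; apply/eqP; apply: contraT => h.
  by have := nmin k h; rewrite leqNgt ltn_ord.
have := hE b n.+1; have := hE b' n.+1; rewrite /u !big_ord_recr /= -/(u b n) -/(u b' n).
rewrite uu EE aS; have := a0 n; move: bn.
by case: (b n); case: (b' n) => //= _; rewrite !ler_norml; lra.
Qed.

(** The rational points below the graph over rational abscissae determine a continuous function, so
    countably many bits encode it. *)
Lemma C01_eq_on_rationals (f g : R -> R) : C01 f -> C01 g ->
  (forall p q : rat, (ratr q < f (ratr p)) = (ratr q < g (ratr p))) -> f = g.
Proof.
suff lt_false (f' g' : R -> R) (x : R) : C01 f' -> C01 g' -> 0 <= x <= 1 -> f' x < g' x ->
    exists p q : rat, (ratr q < f' (ratr p)) != (ratr q < g' (ratr p)).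
  move=> fC gC fg; apply/funext => x.
  have [x01|nx] := pselect (0 <= x <= 1); last by rewrite fC.2 // gC.2.
  apply/eqP; rewrite eq_le !leNgt; apply/andP; split; apply/negP.
    by move=> /(lt_false _ _ _ gC fC x01)[p [q]]; rewrite fg eqxx.
  by move=> /(lt_false _ _ _ fC gC x01)[p [q]]; rewrite fg eqxx.
move=> [/within_continuousP fc _] [/within_continuousP gc _] x01 fg.
have e0 : 0 < (g' x - f' x) / 2 by lra.
have [d1 d10 h1] := fc x x01 _ e0; have [d2 d20 h2] := gc x x01 _ e0.
pose dl := Num.min d1 d2; have dl0 : 0 < dl by rewrite lt_min d10.
have [p] : exists p : rat, ratr p \in `]Num.max 0 (x - dl), Num.min 1 (x + dl)[.
  by apply: rat_in_itvoo; rewrite gt_max !lt_min; lra.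
rewrite in_itv /= gt_max lt_min => /andP[/andP[p0 px] /andP[p1 xp]].
have xpd : `|x - ratr p| < dl by rewrite ltr_norml; lra.
move: (xpd); rewrite lt_min => /andP[xp1 xp2].
have p01 : 0 <= (ratr p : R) <= 1 by lra.
have := h1 _ p01 xp1; have := h2 _ p01 xp2; rewrite !ltr_norml => k1 k2.
have [|q] := @rat_in_itvoo R (f' (ratr p)) (g' (ratr p)); first by lra.
rewrite in_itv /= => /andP[q1 q2]; exists p, q.
by rewrite q2 ltNge (ltW q1).
Qed.

Lemma C01_injection : exists E : (R -> R) -> R, forall f g, C01 f -> C01 g -> E f = E g -> f = g.
Proof.
have [E Einj] := bits_injection.
pose bits (f : R -> R) (n : nat) : bool :=
  if unpickle n is Some (p, q) then ratr (q : rat) < f (ratr (p : rat)) else false.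
exists (fun f => E (bits f)) => f g fC gC /Einj fg.
apply: C01_eq_on_rationals => // p q.
by have := congr1 (fun b => b (pickle (p, q))) fg; rewrite /bits pickleK.
Qed.

(** A Hamel basis extending [range b] contains a copy of the reals and embeds into them through the
    coding of [C01]; Cantor-Bernstein then gives the bijection. *)
Lemma has_dim_continuum (V : set (R -> R)) (b : R -> R -> R) : linear_set V ->
  V `<=` @C01 R -> injective b -> (forall r, V (b r)) -> free_set (range b) -> has_dim V R.
Proof.
move=> Vl VC binj bV bf.
have [|B [bB BV Bf Bs]] := @hamel_extension R V (range b) _ bf.
  by move=> _ [r _ <-].
have [E hE] := C01_injection.
have /card_set_bijP[phi hphi] : ([set: R] #= B)%card.
  apply: Cantor_Bernstein.
    have : (range b #= [set: R])%card by apply: inj_card_eq; exact: in2W.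
    rewrite card_eq_le => /andP[_ h].
    exact: card_le_trans h (subset_card_le bB).
  by apply/pcard_injP; exists E => f g /set_mem/BV/VC fC /set_mem/BV/VC gC; exact: hE.
exact: has_dim_of_bijection hphi.
Qed.

End Cardinality.

(** * Finite index types *)

Section TentIndependence.
Variables (R : realType) (G : R -> R).
Hypothesis Gc : {within `[0, 1%R] : set R, continuous G}.
Hypothesis Gb : forall x, 1 <= G x <= 3.

(* A relation between geometric sequences extends to all polynomials in the
   ratios; Lagrange polynomials isolate the coefficients. *)
Lemma geometric_free (T : eqType) (r : seq T) (tau c : T -> R) : uniq r ->
  {in r &, injective tau} ->
  (forall k : nat, \sum_(f <- r) c f * tau f ^+ k = 0) -> forall f, f \in r -> c f = 0.
Proof.
move=> ur ti h f fr.
have hp (P : {poly R}) : \sum_(g <- r) c g * P.[tau g] = 0.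
  under eq_bigr => g _ do rewrite horner_coef mulr_sumr.
  rewrite exchange_big /= big1 // => k _.
  under eq_bigr => g _ do rewrite mulrCA.
  by rewrite -mulr_sumr h mulr0.
have := hp (\prod_(g <- rem f r) ('X - (tau g)%:P)).
rewrite (big_rem f) //= [X in _ + X]big_seq [X in _ + X]big1 ?addr0 => [/eqP|g gr].
  rewrite mulf_eq0 => /orP[/eqP //|]; rewrite horner_prod prodf_seq_eq0 => /hasP[g gr /=].
  rewrite hornerXsubC subr_eq0 => /eqP /ti fg.
  move: gr; rewrite (rem_filter _ ur) mem_filter /= => /andP[gf gr].
  by move: gf; rewrite -fg // eqxx.
apply/eqP; rewrite mulf_eq0; apply/orP; right.
by rewrite horner_prod prodf_seq_eq0; apply/hasP; exists g => //=; rewrite hornerXsubC subrr.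
Qed.

Lemma tent_continuum : exists b : R -> R -> R,
  [/\ injective b, forall r, tent_space G (b r) & free_set (range b)].
Proof.
(* An injection of the reals into the ratios allowed by [tent_family], between 0 and 1/2. *)
pose t (r : R) : R := (1 + expR r)^-1 / 2.
have e0 (r : R) := expR_gt0 r.
have i0 (r : R) : 0 < (1 + expR r)^-1 by rewrite invr_gt0 addr_gt0.
have t0 r : 0 < t r by rewrite divr_gt0.
have t1 r : t r <= 1 / 2.
  by rewrite /t ler_pM2r ?invr_gt0 // invf_le1 ?lerDl ?ltW // addr_gt0.
have tinj : injective t.
  move=> r r' tt; apply: expR_inj; apply: (addrI 1); apply: invr_inj.
  by apply: (@mulIf _ (2^-1)) tt; rewrite invr_eq0 pnatr_eq0.
have ex r : exists v, tent_space G v /\ forall k, v (peak R k) = t r ^+ k * G (peak R k).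
  by have [v ? ?] := tent_family Gc Gb (t0 r) (t1 r); exists v.
have [b hb] := choice ex.
have G0 x : G x != 0 by rewrite gt_eqF //; have := Gb x; lra.
pose tau (f : R -> R) := f (peak R 1) / G (peak R 1).
have taub r : tau (b r) = t r by rewrite /tau (hb r).2 expr1 mulfK.
have binj : injective b by move=> r r' /(congr1 tau); rewrite !taub => /tinj.
exists b; split => // [r|r c ur rB r0]; first exact: (hb r).1.
apply: (geometric_free (tau := tau) ur) => [f g /rB[u _ <-] /rB[v _ <-]|k].
  by rewrite !taub => /tinj ->.
apply: (mulIf (G0 (peak R k))); rewrite mul0r -[RHS](r0 (peak R k)) mulr_suml !big_seq.
by apply: eq_bigr => f /rB[u _ <-]; rewrite taub (hb u).2 mulrA.
Qed.

End TentIndependence.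

Section Reindexing.
Variables (R : realType) (I J : Type) (h : I -> J).
Hypothesis hinj : injective h.

Lemma extend_along_injection (c : I -> R) : exists k : J -> R, forall i, k (h i) = c i.
Proof.
have ex j : exists x : R, forall i, h i = j -> x = c i.
  have [[i <-]|no] := pselect (exists i, h i = j); first by exists (c i) => i' /hinj ->.
  by exists 0 => i hi; case: no; exists i.
by have [k hk] := choice ex; exists k => i; exact: hk.
Qed.

Lemma lin_indep_comp (b : J -> R -> R) : lin_indep b -> lin_indep (b \o h).
Proof.
move=> bi q c qu q0 i iq; have [k kh] := extend_along_injection c.
rewrite -kh; apply: (bi (map h q)).
- apply/(@list_NoDupP {classic J}); rewrite (@map_inj_uniq {classic I} {classic J}) //.
  exact/(@list_NoDupP {classic I}).
- by move=> x; rewrite big_map -[RHS](q0 x); apply: eq_bigr => j _; rewrite kh.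
- exact: List.in_map.
Qed.

Lemma span_comp (b : J -> R -> R) : span (b \o h) `<=` span b.
Proof.
move=> f [q [c fE]]; have [k kh] := extend_along_injection c.
exists (map h q), k => x; rewrite fE big_map; apply: eq_bigr => j _.
by rewrite kh.
Qed.

End Reindexing.

(** * Extending a finite-dimensional space *)

Section FiniteExtension.
Variables (R : realType) (s : R).
Hypothesis s12 : 1 < s <= 2.
Implicit Types (f g w : R -> R) (d e h t : R).

Let s1 : 1 < s. Proof. by case/andP: s12. Qed.

Lemma Bbar0_C01 f : (Bbar s `|` [set @zerof R]) f -> C01 f.
Proof. by case=> [[]//|->]; exact: C01_zerof. Qed.

Lemma Bbar0_dim f : (Bbar s `|` [set @zerof R]) f -> (upper_box_dim (graph01 f) <= s%:E)%E.
Proof.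
case=> [[_ ->]//|->]; apply: upper_box_dim_le; [exact: C01_zerof|exact: ltW|].
by move=> t _; apply: (@osc_exponent_cst _ _ 0).
Qed.

(** The quantity is the total area of the mesh squares met by the graph. Uniform continuity makes
    the oscillation per column at most [h / 4], over at most [2 / d] columns; the remaining [8 * d]
    is at most [h / 2]. *)
Lemma mesh_area_small f h : C01 f -> 0 < h ->
  exists2 e, 0 < e <= 1 & forall d, 0 < d < e -> d * (d * mesh_count d (graph01 f)) <= h.
Proof.
move=> fC h0; have h4 : 0 < h / 4 by lra.
have [dl dl0 hd] := C01_uniform fC h4.
exists (Num.min 1 (Num.min dl (h / 16))).
  rewrite !lt_min ltr01 dl0 ge_min lexx /= andbT; lra.
move=> d; rewrite !lt_min => /andP[d0 /and3P[d1 ddl dh]].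
have d01 : 0 < d < 1 by rewrite d0.
have hK : osc_le f d (h / 2 / d).
  move=> N x y sel; rewrite ler_pdivlMr //.
  have Nd : N%:R * d <= 2.
    case: N sel => [|N] sel; first by rewrite mul0r.
    by have [x01 _ xN _] := sel N (ltnSn N); rewrite -natr1 mulrDl mul1r; lra.
  have : \sum_(i < N) `|f (x i) - f (y i)| <= \sum_(i < N) h / 4.
    apply: ler_sum => i _; have [x01 y01 xi yi] := sel i (ltn_ord i).
    apply/ltW/hd => //; rewrite -natr1 mulrDl mul1r in xi yi.
    by apply: le_lt_trans ddl; rewrite ler_norml; lra.
  rewrite sumr_const card_ord -[_ *+ N]mulr_natl => hS.
  have : (\sum_(i < N) `|f (x i) - f (y i)|) * d <= N%:R * (h / 4) * d by rewrite ler_pM2r.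
  have : N%:R * d * (h / 4) <= 2 * (h / 4) by rewrite ler_pM2r.
  by rewrite mulrAC; lra.
have := mesh_count_le fC d01 hK; rewrite mulrC => hm.
have : d * (d * mesh_count d (graph01 f)) <= d * (h / 2 / d + 8) by rewrite ler_pM2l.
rewrite (_ : d * (h / 2 / d + 8) = h / 2 + 8 * d); first by lra.
by field; rewrite gt_eqF.
Qed.

(** The function [A] of the gauge: it bounds the oscillation of every listed function. The absolute
    values make it nonnegative at all real [d], as the gauge construction demands. *)
Definition mesh_total (fs : seq (R -> R)) d : R :=
  \sum_(f <- fs) `|d * mesh_count d (graph01 f)|.

Lemma mesh_total_ge0 fs d : 0 <= mesh_total fs d.
Proof. by apply: sumr_ge0. Qed.

Lemma mesh_norm d f : 0 < d ->
  `|d * mesh_count d (graph01 f)| = d * mesh_count d (graph01 f).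
Proof. by move=> d0; rewrite ger0_norm // mulr_ge0 ?mesh_count_ge0 // ltW. Qed.

Lemma mesh_total_exponent fs t :
  (forall f, List.In f fs -> (Bbar s `|` [set @zerof R]) f) -> s - 1 < t ->
  exists2 e, 0 < e <= 1 & forall d, 0 < d < e -> mesh_total fs d <= d `^ (- t).
Proof.
elim: fs t => [|f fs IH] t fB st.
  by exists 1; [rewrite ltr01 lexx|move=> d _; rewrite /mesh_total big_nil powR_ge0].
have st' : s - 1 < (s - 1 + t) / 2 by lra.
have t't : (s - 1 + t) / 2 < t by lra.
have [|e1 /andP[e10 e11] h1] := IH _ _ st'; first by move=> g gs; apply: fB; right.
have fB' := fB f (or_introl erefl).
have [e2 /andP[e20 e21] h2] := upper_box_dim_le_inv (Bbar0_C01 fB') (Bbar0_dim fB') st'.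
have [e3 /andP[e30 e31] h3] := powR_eventually_le 2 t't.
exists (Num.min e1 (Num.min e2 e3)).
  by rewrite !lt_min e10 e20 e30 ge_min e11.
move=> d; rewrite !lt_min => /andP[d0 /and3P[d1 d2 d3]].
rewrite /mesh_total big_cons -/(mesh_total fs d) mesh_norm //.
have := h1 d; have := h2 d; have := h3 d; rewrite d0 d1 d2 d3.
by move=> /(_ isT) k3 /(_ isT) k2 /(_ isT) k1; lra.
Qed.

Lemma mesh_total_small fs h : (forall f, List.In f fs -> C01 f) -> 0 < h ->
  exists2 e, 0 < e <= 1 & forall d, 0 < d < e -> d * mesh_total fs d <= h.
Proof.
elim: fs h => [|f fs IH] h fC h0.
  exists 1; [by rewrite ltr01 lexx|move=> d _; rewrite /mesh_total big_nil mulr0; exact: ltW].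
have h2 : 0 < h / 2 by lra.
have [|e1 /andP[e10 e11] k1] := IH _ _ h2; first by move=> g gs; apply: fC; right.
have [e2 /andP[e20 e21] k2] := mesh_area_small (fC f (or_introl erefl)) h2.
exists (Num.min e1 e2); first by rewrite !lt_min e10 e20 ge_min e11.
move=> d; rewrite !lt_min => /and3P[d0 d1 d2].
rewrite /mesh_total big_cons -/(mesh_total fs d) mesh_norm // mulrDr.
by have := k1 d; have := k2 d; rewrite d0 d1 d2 => /(_ isT) ? /(_ isT) ?; lra.
Qed.

Lemma mesh_total_osc fs f d : List.In f fs -> C01 f -> 0 < d < 1 ->
  osc_le f d (mesh_total fs d).
Proof.
move=> ffs fC d01 N x y sel; apply: le_trans (osc_le_mesh fC d01 sel) _.
rewrite -mesh_norm; last by case/andP: d01.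
elim: fs ffs => //= g fs IH; rewrite /mesh_total big_cons -/(mesh_total fs d) => -[->|/IH h].
  by rewrite lerDl mesh_total_ge0.
by apply: le_trans h _; rewrite lerDr.
Qed.

Lemma osc_le_sum (I : Type) (b : I -> R -> R) (r : seq I) (c : I -> R) d K :
  (forall i, osc_le (b i) d K) ->
  osc_le (fun x => \sum_(i <- r) c i * b i x) d ((\sum_(i <- r) `|c i|) * K).
Proof.
move=> hb; elim: r => [|i r IH].
  rewrite big_nil mul0r => N x y _; rewrite big1 // => k _.
  by rewrite !big_nil subrr normr0.
rewrite big_cons mulrDl; have := osc_le_lin (c i) 1 (hb i) IH; rewrite normr1 mul1r.
by apply: osc_le_eq => x _; rewrite big_cons mul1r.
Qed.

Lemma finite_extension (I : Type) (enumI : seq I) W : (forall i, List.In i enumI) ->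
  has_dim W I -> W `<=` Bbar s `|` [set @zerof R] ->
  exists V, has_dim V R /\ sup_closed V /\ W `<=` V /\ V `<=` Bbar s `|` [set @zerof R].
Proof.
move=> enumP [b [bi ->]] bs.
have bB i : (Bbar s `|` [set @zerof R]) (b i) by exact/bs/span_basis.
pose fs := map b enumI.
have fsB f : List.In f fs -> (Bbar s `|` [set @zerof R]) f.
  by move=> /List.in_map_iff[i [<- _]].
have infs i : List.In (b i) fs by apply: List.in_map.
have [G [Gc Gb Gexp Glarge]] := gauge_exists s12 (mesh_total_ge0 fs)
   (fun t => mesh_total_exponent fsB) (fun h => mesh_total_small (fun f ffs => Bbar0_C01 (fsB f ffs))).
have V0l : linear_set (tent_space G).
  split; first exact: tent_space_zerof.
  by move=> f g u v; exact: tent_space_lin.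
have V0C : tent_space G `<=` @C01 R by move=> f [].
have [V [[Vl VC Vc] V0V fsV VM]] := closed_extension V0l V0C (tent_space_closed Gb)
   (fun f ffs => Bbar0_C01 (fsB f ffs)).
exists V; split; last split => //; last split.
- have [c [cinj cT cfree]] := tent_continuum Gc Gb.
  by apply: has_dim_continuum cfree => // r; exact/V0V.
- by apply: span_sub => // i; exact: fsV.
move=> f fV.
have [|g gW gf] := VM _ (linear_span b) _ f fV.
  by move=> u /List.in_map_iff[i [<- _]]; exact: span_basis.
have gB := bs g gW.
(* Without tent part, [f] lies in the given space, where membership is assumed; otherwise the
   nonzero tent part forces the lower bound. *)
have [v0|v0] := pselect ((fun x => f x - g x) = @zerof R).
  rewrite (_ : f = g) //; apply/funext => x; apply/eqP; rewrite -subr_eq0.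
  by apply/eqP; exact: (congr1 (fun u => u x) v0).
have fC : C01 f by exact: VC.
left; split => //; apply/eqP; rewrite eq_le; apply/andP; split.
  apply: upper_box_dim_le => //; first exact: ltW.
  move=> t st; have t0 : 0 < t by have := s1; lra.
  have := osc_exponent_lin 1 1 (osc_exponent_dim (Bbar0_C01 gB) (Bbar0_dim gB) st)
     (tent_space_exponent Gb t0 (Gexp t st) gf).
  by rewrite (_ : (fun x => _) = f) //; apply/funext => x; ring.
apply: upper_box_dim_ge => // t st e e0.
have [r [c gE]] := gW.
have gosc d : 0 < d < 1 -> osc_le g d ((\sum_(i <- r) `|c i|) * mesh_total fs d).
  move=> d01; apply: (@osc_le_eq _ (fun x => \sum_(i <- r) c i * b i x)) => //.
  by apply: osc_le_sum => i; apply: mesh_total_osc => //; exact: Bbar0_C01.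
have La0 : 0 <= \sum_(i <- r) `|c i| by apply: sumr_ge0.
have [d [de [N [x [y [sel hS]]]]]] := tent_space_lower Gb s1 (mesh_total_ge0 fs) Glarge
  gf v0 La0 gosc st e0.
exists d; split => //; exists N, x, y; split => //.
apply: le_trans hS _; apply: ler_sum => i _.
by rewrite le_eqVlt; apply/orP; left; apply/eqP; congr (`|_|); ring.
Qed.

Lemma finite_spaceable (I : Type) : finite_set [set: I] -> spaceable (Bbar s) I R.
Proof.
move=> /(@finite_seqP {classic I})[r rE].
have rI (i : {classic I}) : i \in r by have : [set: {classic I}] i by []; rewrite rE.
have rP (i : I) : List.In i r by exact/(@list_InP {classic I}).
pose h (i : I) : R := (index (i : {classic I}) r)%:R.
have hinj : injective h.
  move=> i j /eqP; rewrite eqr_nat => /eqP ij.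
  by rewrite -(@nth_index {classic I} i i r) // ij nth_index.
have ext W : has_dim W I -> W `<=` Bbar s `|` [set @zerof R] ->
    exists V, has_dim V R /\ sup_closed V /\ W `<=` V /\ V `<=` Bbar s `|` [set @zerof R].
  exact: finite_extension rP.
split; last split => //.
  split; first by exists h.
  move=> [g ginj].
  have := @uniq_leq_size {classic I} (map (fun n : nat => g n%:R) (iota 0 (size r).+1)) r.
  rewrite size_map size_iota ltnn => contra; suff : false by [].
  apply: contra => [|i _]; last exact: rI.
  rewrite (@map_inj_uniq _ {classic I}) ?iota_uniq // => m n /ginj /eqP.
  by rewrite eqr_nat => /eqP.
(* Lineability comes from the extension result itself: the zero space, with basis indexed by [void],
   extends to a space of dimension [R], and a subfamily of its basis along [h] spans one of
   dimension [I]. *)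
have W0 : has_dim [set @zerof R] void.
  exists (fun i : void => match i with end); split; first by move=> q c _ _ [].
  apply/seteqP; split => f.
    by move=> ->; exists [::], (fun=> 0) => x; rewrite big_nil.
  by move=> [[|[]] [c fE]]; apply/funext => x; rewrite fE big_nil.
have [||V [[b [bi VE]] [_ [_ VB]]]] := @finite_extension void [::] _ _ W0.
- by case.
- by move=> f ->; right.
exists (span (b \o h)); split.
  by exists (b \o h); split => //; exact: lin_indep_comp.
by move=> f /(span_comp hinj) fb; apply: VB; rewrite VE.
Qed.

End FiniteExtension.

Theorem theorem4p2 (R : realType) (s : R) (hs : 1 < s <= 2) (I : Type) :
  spaceable (Bbar s) I R <-> finite_set [set: I].
Proof.
split; first by apply: spaceable_finite; case/andP: hs.
exact: finite_spaceable.
Qed.
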